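(* Let $m\ge 1$, let $\mathcal A_m=\mathbb Z[x]/(x^m)$, and let $P_3$ be the triangle graph. The cohomology groups $H^{*,*}_{\mathcal A_m}(P_3)$ are completely determined by the following. (Torsion) $\mathrm{Tor}(H^{*,*}_{\mathcal A_m}(P_3))=H^{1,m}_{\mathcal A_m}(P_3)\cong\mathbb Z_m$; that is, the torsion subgroup of $\bigoplus_{i,j}H^{i,j}_{\mathcal A_m}(P_3)$ is exactly $H^{1,m}_{\mathcal A_m}(P_3)$, which is cyclic of order $m$. (Free) The Poincaré polynomial of $H^{*,*}_{\mathcal A_m}(P_3)$ is equal to $(q+q^2+\dots+q^{m-1})^3+t(q+q^2+\dots+q^{m-1})$.
   Context: $\mathcal A=\mathcal A_m=\mathbb Z[x]/(x^m)$ is graded with $\deg x^a=a$. $\mathbb Z_m=\mathbb Z/m\mathbb Z$. The triangle $P_3$ has 3 vertices and 3 edges forming a cycle. Graph cohomology over $\mathcal A$: let $G$ be a finite graph with ordered edges $e_1,\dots,e_n$. For $s\subseteq E(G)$ let $[G:s]$ be the graph with vertex set $V(G)$ and edge set $s$, and let $C^{s}(G)=\mathcal A^{\otimes k}$ (tensor over $\mathbb Z$, one factor per connected component of $[G:s]$, $k$ being the number of components), with the induced grading. Put $C^i(G)=\bigoplus_{|s|=i}C^s(G)$. For $e\notin s$ the per-edge map $C^{s}(G)\to C^{s\cup\{e\}}(G)$ is the identity if $e$ joins a component of $[G:s]$ to itself; if $e$ joins two different components it multiplies the two corresponding tensor factors via $\mathcal A\otimes\mathcal A\to\mathcal A$ and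 is the identity on the other factors. The differential $d^i:C^i(G)\to C^{i+1}(G)$ is the sum of the per-edge maps over all $|s|=i$ and $e=e_r\notin s$, with sign $(-1)^{\#\{t<r:\ e_t\in s\}}$. It preserves degree; $H^{i,j}_{\mathcal A}(G)$ is the degree $j$ part of the $i$-th cohomology $H^i_{\mathcal A}(G)$. The Poincaré polynomial (series) of a family $\{M^{i,j}\}$ of abelian groups is $\sum_{i,j}t^iq^j\dim_{\mathbb Q}(M^{i,j}\otimes_{\mathbb Z}\mathbb Q)$. *)

(* Defs.v *)
From HB Require Import structures.
From mathcomp Require Import all_boot all_order all_algebra.
From mathcomp Require Import boolp classical_sets.

Set Implicit Arguments.
Unset Strict Implicit.
Unset Printing Implicit Defensive.

Import GRing.Theory.
Local Open Scope ring_scope.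
Local Open Scope quotient_scope.

Section Products.
Variables (K : Type) (M : K -> zmodType).

Definition dprod : Type := forall k, M k.

HB.instance Definition _ := gen_eqMixin dprod.
HB.instance Definition _ := gen_choiceMixin dprod.

Let dprod_add (x y : dprod) : dprod := fun k => x k + y k.
Let dprod_opp (x : dprod) : dprod := fun k => - x k.
Let dprod_zero : dprod := fun=> 0.

Fact dprod_addA : associative dprod_add.
Proof. by move=> x y z; apply: functional_extensionality_dep => k; apply: addrA. Qed.
Fact dprod_addC : commutative dprod_add.
Proof. by move=> x y; apply: functional_extensionality_dep => k; apply: addrC. Qed.
Fact dprod_add0 : left_id dprod_zero dprod_add.
Proof. by move=> x; apply: functional_extensionality_dep => k; apply: add0r. Qed.
Fact dprod_addN : left_inverse dprod_zero dprod_opp dprod_add.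
Proof. by move=> x; apply: functional_extensionality_dep => k; apply: addNr. Qed.

HB.instance Definition _ :=
  GRing.isZmodule.Build dprod dprod_addA dprod_addC dprod_add0 dprod_addN.

Lemma dprodBE (x y : dprod) k : (x - y) k = x k - y k. Proof. by []. Qed.

Lemma dprod0E k : (0 : dprod) k = 0. Proof. by []. Qed.

End Products.

Section DirectSum.
Variables (K : choiceType) (M : K -> zmodType).

Definition finite_support : {pred dprod M} := fun x =>
  `[< exists s : seq K, forall k, k \notin s -> x k = 0 >].

Fact finite_support_closed : zmod_closed finite_support.
Proof.
split=> [|x y /asboolP[s xs] /asboolP[t yt]]; apply/asboolP; first by exists [::].
exists (s ++ t) => k; rewrite mem_cat negb_or => /andP[ks kt].
by rewrite dprodBE xs // yt // subrr.
Qed.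

HB.instance Definition _ :=
  GRing.isZmodClosed.Build (dprod M) finite_support finite_support_closed.

Record dsum : Type := DSum { dsum_val :> dprod M; _ : dsum_val \in finite_support }.

HB.instance Definition _ := [isSub for dsum_val].
HB.instance Definition _ := [Choice of dsum by <:].
HB.instance Definition _ := [SubChoice_isSubZmodule of dsum by <:].

(* The direct summand M k, as a subgroup of the direct sum. *)
Definition summand (k : K) : set dsum :=
  [set x | forall l, l <> k -> (x : dprod M) l = 0].

End DirectSum.

Definition torsion (M : zmodType) : set M :=
  [set x | exists2 n : nat, (0 < n)%N & x *+ n = 0].
Arguments torsion : clear implicits.

(* iota : M -> V presents the rational vector space V as the tensor product   *)
(* M (x)_Z rat: it is universal among additive maps from M to rational vector *)
(* spaces.                                                                    *)
Definition is_tensor_rat (M : zmodType) (V : lmodType rat)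
    (iota : {additive M -> V}) : Prop :=
  forall W : lmodType rat,
    (forall f : {additive M -> W}, exists g : {linear V -> W}, g \o iota =1 f)
    /\ (forall g1 g2 : {linear V -> W}, g1 \o iota =1 g2 \o iota -> g1 =1 g2).

Definition dim_tensor_rat (M : zmodType) (r : nat) : Prop :=
  exists (V : vectType rat) (iota : {additive M -> V}),
    is_tensor_rat iota /\ \dim {:V} = r.

(* In P the outer variable is t and the inner one is q.                       *)
Definition is_poincare (M : nat -> nat -> zmodType) (P : {poly {poly nat}}) :
    Prop :=
  forall i j, dim_tensor_rat (M i j) (P`_i`_j)%R.

Definition update (I : eqType) (T : Type) (f : I -> T) (i : I) (x : T) : I -> T :=
  fun j => if j == i then x else f j.

Section TensorPowers.
Variable m : nat.

(* Z[x]/(x^m), for m > 0 (for m = 0 the library quotients by 'X instead).     *)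
Definition algA := {poly %/ ('X^m : {poly int})}.

Definition algA_X : algA := in_qpoly _ 'X.

HB.instance Definition _ := GRing.ComNzRing.on algA.

(* The tensor power of algA over Z with one factor for each i : I. It is free *)
(* on the tensors of powers of x, which are indexed by a : {ffun I -> 'I_m},  *)
(* and its elements are given by their coordinates on this basis.             *)
(* See tpow_universal below.                                                  *)
Definition tpow (I : finType) := {ffun {ffun I -> 'I_m} -> int}.

HB.instance Definition _ (I : finType) := GRing.Zmodule.on (tpow I).

Definition tens (I : finType) (f : I -> algA) : tpow I :=
  [ffun a : {ffun I -> 'I_m} => \prod_i (f i : {poly int})`_(a i)].

Definition tpow_extend (I : finType) (W : zmodType) (phi : (I -> algA) -> W)
    (v : tpow I) : W :=
  \sum_(a : {ffun I -> 'I_m}) phi (fun i => algA_X ^+ a i) *~ v a.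

(* Multiplies together, for each j, the factors i with p i = j (the empty     *)
(* product being 1). See tpow_mul_tens below.                                 *)
Definition tpow_mul (I J : finType) (p : I -> J) : tpow I -> tpow J :=
  tpow_extend (fun f => tens (fun j => \prod_(i | p i == j) f i)).

Definition homogeneous (I : finType) (j : nat) (v : tpow I) : Prop :=
  forall a : {ffun I -> 'I_m}, v a != 0 -> (\sum_i a i)%N = j.

Definition multilinear (I : finType) (W : zmodType) (phi : (I -> algA) -> W) :
    Prop :=
  forall (f : I -> algA) (i : I) (x y : algA),
    phi (update f i (x - y)) = phi (update f i x) - phi (update f i y).

End TensorPowers.

Section TensorPowerTheory.
Variables (m : nat) (m_gt0 : (0 < m)%N).
Local Notation A := (algA m).
Local Notation X := (algA_X m).

Let mk_mX : mk_monic ('X^m : {poly int}) = 'X^m.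
Proof. by rewrite mk_monic_Xn prednK. Qed.

Lemma algA_XnE k : (k < m)%N -> (X ^+ k : A) = 'X^k :> {poly int}.
Proof.
move=> km; rewrite /algA_X.
have -> : (in_qpoly 'X^m 'X ^+ k : A) = in_qpoly ('X^m : {poly int}) 'X^k.
  by elim: k {km} => [|k IH]; rewrite ?in_qpoly1// !exprS in_qpolyM IH.
by rewrite in_qpoly_small// mk_mX !size_polyXn.
Qed.

Lemma algA_sum (x : A) : x = \sum_(k < m) X ^+ k *~ (x : {poly int})`_k.
Proof.
have sx : (size (x : {poly int}) <= m)%N.
  have sm : size (mk_monic ('X^m : {poly int})) = m.+1 by rewrite mk_mX size_polyXn.
  by rewrite -ltnS -[X in (_ < X)%N]sm; apply: size_mk_monic.
apply: val_inj => /=.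
have -> : polyn (\sum_(k < m) X ^+ k *~ (x : {poly int})`_k) =
    \sum_(k < m) polyn (X ^+ k *~ (x : {poly int})`_k) :> {poly int}.
  exact: raddf_sum.
rewrite -[LHS](coefK x) poly_def (big_ord_widen m (fun k => x`_k *: 'X^k))//.
rewrite big_mkcond/=; apply: eq_bigr => k _.
have -> : polyn (X ^+ k *~ (x : {poly int})`_k) =
    polyn (X ^+ k) *~ (x : {poly int})`_k :> {poly int}.
  exact: raddfMz.
rewrite algA_XnE// -scaler_int intz; case: ifPn => //.
by rewrite -leqNgt => /(nth_default 0) ->; rewrite scale0r.
Qed.

Section Multilinear.
Variables (I : finType) (W : zmodType).
Implicit Types phi psi : (I -> A) -> W.

Lemma update_id (f : I -> A) i : update f i (f i) = f.
Proof.
by apply: functional_extensionality_dep => j; rewrite /update; case: eqP => [->|].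
Qed.

Lemma multilinear_sum phi (f : I -> A) i : multilinear phi ->
  phi f = \sum_(k < m) phi (update f i (X ^+ k)) *~ (f i : {poly int})`_k.
Proof.
move=> phiB; pose g := fun x : A => phi (update f i x).
pose gM := GRing.isZmodMorphism.Build A W g (phiB f i).
pose ga : {additive A -> W} := HB.pack g gM.
have -> : phi f = ga (f i) by rewrite /= /g update_id.
rewrite {1}(algA_sum (f i)) raddf_sum.
by apply: eq_bigr => k _; rewrite raddfMz.
Qed.

Lemma multilinear_ext phi psi : multilinear phi -> multilinear psi ->
  (forall a : {ffun I -> 'I_m},
     phi (fun i => X ^+ a i) = psi (fun i => X ^+ a i)) ->
  phi =1 psi.
Proof.
move=> phiB psiB e f.
pose bad (f : I -> A) := [pred i | ~~ [exists k : 'I_m, f i == X ^+ k]].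
move: {2}(#|bad f|) (leqnn #|bad f|) => n; elim: n f => [|n IH] f.
  rewrite leqn0 => /eqP/card0_eq bad0.
  have k_ i : exists k : 'I_m, f i == X ^+ k.
    by apply/existsP; have := bad0 i; rewrite !inE => /negbFE.
  pose a := [ffun i => xchoose (k_ i)].
  suff -> : f = (fun i => X ^+ a i) by [].
  apply: functional_extensionality_dep => i; rewrite ffunE.
  exact/eqP/(xchooseP (k_ i)).
move=> badn; have [/eqP bad0|] := boolP (#|bad f| == 0%N).
  by apply: IH; rewrite bad0.
rewrite -lt0n => /card_gt0P[i ibad].
rewrite (multilinear_sum f i phiB) (multilinear_sum f i psiB).
apply: eq_bigr => k _; congr (_ *~ _); apply: IH.
rewrite -ltnS (leq_trans _ badn)// proper_card//; apply/properP; split.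
  apply/fintype.subsetP => j; rewrite !inE /update.
  by case: eqP => // _ /negP[]; apply/existsP; exists k.
exists i => //; rewrite !inE negbK /update eqxx.
by apply/existsP; exists k.
Qed.

End Multilinear.

Lemma prod_update (R : comNzRingType) (I : finType) (P : pred I) (f : I -> A)
    (F : I -> A -> R) i x :
  \prod_(j | P j) F j (update f i x j) =
    (if P i then F i x else 1) * \prod_(j | P j && (j != i)) F j (f j).
Proof.
have out : \prod_(j | P j && (j != i)) F j (update f i x j) =
    \prod_(j | P j && (j != i)) F j (f j).
  by apply: eq_bigr => j /andP[_ ji]; rewrite /update (negbTE ji).
case: ifPn => Pi; first by rewrite (bigD1 i)//= out /update eqxx.
rewrite mul1r -out; apply: eq_bigl => j.
by case: (eqVneq j i) => [->|]; rewrite ?(negbTE Pi)// andbT.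
Qed.

Lemma tens_multilinear (I : finType) : multilinear (@tens m I).
Proof.
move=> f i x y; apply/ffunP => a; rewrite !ffunE.
have E (z : A) := prod_update xpredT f
  (fun j (z : A) => (z : {poly int})`_(a j)) i z.
rewrite !E -mulrBl; congr (_ * _).
by rewrite -coefB.
Qed.

Lemma tens_mono (I : finType) (a : {ffun I -> 'I_m}) :
  tens (fun i => X ^+ a i) = [ffun b => (b == a)%:R].
Proof.
apply/ffunP => b; rewrite !ffunE.
under eq_bigr => i _ do rewrite algA_XnE// coefXn.
have [->|ba] := eqVneq b a; first by rewrite big1// => i _; rewrite eqxx.
have /existsP[i bai] : [exists i, b i != a i].
  apply: contraR ba => /existsPn ab; apply/eqP/ffunP => i.
  by apply/eqP; have := ab i; rewrite negbK.
by rewrite (bigD1 i)//= (_ : _ == _ = false) ?mul0r//; apply: negbTE.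
Qed.

Section Extend.
Variables (I : finType) (W : zmodType) (phi : (I -> A) -> W).

Fact tpow_extend_is_additive : zmod_morphism (tpow_extend phi).
Proof.
move=> u v; rewrite /tpow_extend -sumrB; apply: eq_bigr => a _.
by rewrite !ffunE mulrzBr.
Qed.
End Extend.
End TensorPowerTheory.

HB.instance Definition _ (m : nat) (I : finType) (W : zmodType)
    (phi : (I -> algA m) -> W) :=
  GRing.isZmodMorphism.Build (tpow m I) W (tpow_extend phi)
    (tpow_extend_is_additive phi).

HB.instance Definition _ (m : nat) (I J : finType) (p : I -> J) :=
  GRing.isZmodMorphism.Build (tpow m I) (tpow m J) (tpow_mul p)
    (tpow_extend_is_additive _).

Section TensorPowerUniversal.
Variables (m : nat) (m_gt0 : (0 < m)%N).
Local Notation A := (algA m).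
Local Notation X := (algA_X m).

Lemma tpow_extend_tens (I : finType) (W : zmodType) (phi : (I -> A) -> W) :
  multilinear phi -> forall f, tpow_extend phi (tens f) = phi f.
Proof.
move=> phiB; apply: (multilinear_ext m_gt0) => //.
  by move=> f i x y; rewrite tens_multilinear raddfB.
move=> a; rewrite tens_mono// /tpow_extend (bigD1 a)//= ffunE eqxx.
by rewrite big1 ?addr0// => b /negbTE ba; rewrite ffunE ba.
Qed.

Theorem tpow_universal (I : finType) (W : zmodType) (phi : (I -> A) -> W) :
  multilinear phi ->
  (exists g : {additive tpow m I -> W}, forall f, g (tens f) = phi f)
  /\ (forall g1 g2 : {additive tpow m I -> W},
        (forall f, g1 (tens f) = g2 (tens f)) -> g1 =1 g2).
Proof.
move=> phiB; split; first by exists (tpow_extend phi); apply: tpow_extend_tens.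
move=> g1 g2 g12 v.
have -> : v = \sum_(a : {ffun I -> 'I_m}) tens (fun i => X ^+ a i) *~ v a.
  apply/ffunP => b; rewrite sum_ffunE (bigD1 b)//= big1 ?addr0.
    by rewrite tens_mono// ffunMzE ffunE eqxx intz.
  move=> a ab; rewrite tens_mono// ffunMzE ffunE eq_sym (negbTE ab).
  by rewrite mul0rz.
by rewrite !raddf_sum; apply: eq_bigr => a _; rewrite !raddfMz g12.
Qed.

Lemma tpow_mul_tens (I J : finType) (p : I -> J) (f : I -> A) :
  tpow_mul p (tens f) = tens (fun j => \prod_(i | p i == j) f i).
Proof.
apply: tpow_extend_tens => {}f i x y.
have E z : (fun j => \prod_(i0 | p i0 == j) update f i z i0) =
    update (fun j => \prod_(i0 | p i0 == j) f i0) (p i)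
      (z * \prod_(i0 | (p i0 == p i) && (i0 != i)) f i0).
  apply: functional_extensionality_dep => j.
  have := @prod_update _ A I (fun i0 => p i0 == j) f (fun=> id) i z.
  move=> /= ->; rewrite /update eq_sym; case: eqVneq => [->//|pij].
  rewrite mul1r; apply: eq_bigl => k.
  by case: (eqVneq k i) => [->|]; rewrite ?andbT// eq_sym (negbTE pij).
by rewrite !E mulrBl tens_multilinear.
Qed.

End TensorPowerUniversal.

(* A finite graph (loops and multiple edges allowed) with ordered edges.      *)
Record graph := Graph {
  vertex : finType;
  nedges : nat;
  ends : 'I_nedges -> vertex * vertex
}.

Definition triangle : graph :=
  @Graph 'I_3 3 (fun i => (i, ordS i)).

Section Components.
Variable G : graph.
Implicit Type s : {set 'I_(nedges G)}.

Definition adjacent s : rel (vertex G) := fun u v =>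
  [exists r in s, (ends r == (u, v)) || (ends r == (v, u))].

Lemma adjacent_sym s : symmetric (adjacent s).
Proof. by move=> u v; apply: eq_existsb => r; rewrite orbC. Qed.

(* A component of [G : s] is represented by its canonical vertex.             *)
Definition component s : finType := {u : vertex G | u \in roots (adjacent s)}.

Fact component_of_subproof s u : fingraph.root (adjacent s) u \in roots (adjacent s).
Proof. exact/roots_root/sym_connect_sym/adjacent_sym. Qed.

Definition component_of s (u : vertex G) : component s :=
  Sub (fingraph.root (adjacent s) u) (component_of_subproof s u).

End Components.

Section Cohomology.
Variables (m : nat) (G : graph).

Definition edge_subset (i : nat) : finType :=
  {s : {set 'I_(nedges G)} | #|s| == i}.

(* The direct sum is over a finite set, hence is a product.                   *)
Definition cochain (i : nat) : zmodType :=
  dprod (fun s : edge_subset i => tpow m (component (val s))).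

(* For s contained in s', a component of [G : s] is sent to the component of  *)
(* [G : s'] containing it. If s' is s with one more edge e, this is a         *)
(* bijection when e joins a component to itself, and it identifies exactly    *)
(* the two components that e joins otherwise.                                 *)
Definition edge_map (s s' : {set 'I_(nedges G)}) :
    tpow m (component s) -> tpow m (component s') :=
  tpow_mul (fun c => component_of s' (val c)).

HB.instance Definition _ s s' :=
  GRing.isZmodMorphism.Build (tpow m (component s)) (tpow m (component s'))
    (@edge_map s s') (tpow_extend_is_additive _).

Definition differential (i : nat) (v : cochain i) : cochain i.+1 := fun s' =>
  \sum_(s : edge_subset i)
    \sum_(r | (r \notin val s) && (val s' == r |: val s))
      @edge_map (val s) (val s') (v s)
        *~ (-1) ^+ #|[set t in val s | (t < r)%N]|.

Fact differential_is_additive i : zmod_morphism (@differential i).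
Proof.
move=> u v; apply: functional_extensionality_dep => s'; rewrite dprodBE.
rewrite /differential -sumrB; apply: eq_bigr => s _.
by rewrite -sumrB; apply: eq_bigr => r _; rewrite dprodBE raddfB mulrzBl.
Qed.

HB.instance Definition _ i :=
  GRing.isZmodMorphism.Build (cochain i) (cochain i.+1) (@differential i)
    (@differential_is_additive i).

Section Degree.
Variable i : nat.

Definition is_cocycle : {pred cochain i} := fun v => differential v == 0.

Fact is_cocycle_closed : zmod_closed is_cocycle.
Proof.
split=> [|u v /eqP du /eqP dv]; rewrite unfold_in; first by rewrite raddf0.
by rewrite raddfB /= du dv subrr.
Qed.

HB.instance Definition _ :=
  GRing.isZmodClosed.Build (cochain i) is_cocycle is_cocycle_closed.

Record cocycle : Type := Cocycle { cocycle_val :> cochain i; _ : cocycle_val \in is_cocycle }.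

HB.instance Definition _ := [isSub for cocycle_val].
HB.instance Definition _ := [Choice of cocycle by <:].
HB.instance Definition _ := [SubChoice_isSubZmodule of cocycle by <:].

Definition in_image : cochain i -> Prop :=
  match i with
  | 0 => fun v => v = 0
  | k.+1 => fun v => exists u : cochain k, differential u = v
  end.

Definition is_coboundary : {pred cocycle} := fun z => `[< in_image (val z) >].

Fact is_coboundary_closed : zmod_closed is_coboundary.
Proof.
suff [H0 HB] : in_image 0 /\
    forall u v, in_image u -> in_image v -> in_image (u - v).
  split=> [|x y /asboolP xI /asboolP yI]; apply/asboolP; first exact: H0.
  exact: HB.
rewrite /in_image; case: i => [|k].
  by split=> // u v -> ->; rewrite subrr.
split=> [|u v [x <-] [y <-]]; first by exists 0; rewrite raddf0.
by exists (x - y); rewrite raddfB.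
Qed.

HB.instance Definition _ :=
  GRing.isZmodClosed.Build cocycle is_coboundary is_coboundary_closed.

Definition cohomology : zmodType := Quotient.quot is_coboundary.

Variable j : nat.

Definition cohomology_degree : {pred cohomology} := fun h =>
  `[< exists z : cocycle,
        (forall s, homogeneous j ((z : cochain i) s)) /\ \pi_(Quotient.quot is_coboundary) z = h >].

Fact cohomology_degree_closed : zmod_closed cohomology_degree.
Proof.
split=> [|g h /asboolP[y [yj <-]] /asboolP[z [zj <-]]]; apply/asboolP.
  exists 0; split; last exact: raddf0.
  by move=> s a; rewrite /= dprod0E ffunE eqxx.
exists (y - z); split; last exact: raddfB.
move=> s a; rewrite /= dprodBE !ffunE => yz.
have [ya|ya] := eqVneq ((y : cochain i) s a) 0; last exact: yj ya.
by apply: (zj s a); apply: contraNneq yz => za; rewrite ya za subrr.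
Qed.

HB.instance Definition _ :=
  GRing.isZmodClosed.Build cohomology cohomology_degree cohomology_degree_closed.

Record bigraded_cohomology : Type := BigradedCohomology {
  bigraded_cohomology_val :> cohomology;
  _ : bigraded_cohomology_val \in cohomology_degree
}.

HB.instance Definition _ := [isSub for bigraded_cohomology_val].
HB.instance Definition _ := [Choice of bigraded_cohomology by <:].
HB.instance Definition _ := [SubChoice_isSubZmodule of bigraded_cohomology by <:].

End Degree.
End Cohomology.

(* Main.v *)
(* Everything is computed on monomial bases, degree by degree.                *)
(*                                                                            *)
(* In H^1, the image of x^a (x) 1 (x) x^c allows one to clear a cocycle on    *)
(* the first edge, and then those of x^a (x) x^b (x) 1 - x^(a+b) (x) 1 (x) 1  *)
(* clear it on the third one. In degree j this leaves on the second edge the  *)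
(* classes Y_p of x^p (x) x^(j-p) - 1 (x) x^j, subject to                     *)
(* Y_(p+q) = Y_p + Y_q, with Y_p = 0 as soon as an exponent reaches m. So H^1 *)
(* is generated by Y_1, which is free for 0 < j < m, of order m for j = m     *)
(* since Y_m = 0, and zero otherwise.                                         *)
(*                                                                            *)
(* The kernel of d^0 lies in that of the path x - y - z, which is free on the *)
(* (x^a - y^a) y^b (z^c - y^c) with a, c > 0; putting z = x gives             *)
(* Y_(a+c) - Y_a - Y_c, and solving for the coordinates with c = 1 leaves     *)
(* free coordinates in bijection with triples of exponents in [1, m - 1].     *)
(* In H^2 and H^3, preimages are written down directly.                       *)

(* On monomials the maps of the complex only add exponents, and a monomial is zero as soon as one of
   its exponents reaches [m]. Each bidegree thus becomes a question about integer coordinates. By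
   [bigraded_iso] it suffices to find an additive map on cochains which is onto when restricted to
   homogeneous cocycles and which vanishes on exactly the coboundaries among them.

   In cohomological degree 0 this map is the projection to the coordinates of [h0_index]. It is
   injective on the kernel because the kernel equations determine all other coordinates
   ([rigidity]), and onto because explicit cocycles form a dual basis ([h0_coord_delta]). The
   bijection behind [card_h0_index] turns the rank into the number of triples of positive exponents
   below [m] with sum [j], a coefficient of the cube in the Poincaré polynomial.

   In cohomological degree 1 the map is [h1_class]. A cocycle is congruent to its class times one
   generator ([h1_reduction]). The class of a coboundary is zero for [j < m] and a multiple of [m]
   for [j = m] ([h1_class_differential]), and [m] times the generator of degree [m] is a coboundary
   ([h1_gen_torsion]). This gives Z for [0 < j < m] and Z/m for [j = m]; the remaining degrees
   vanish by [h1_trivial]. Higher cohomology vanishes by [triangle_H2], [triangle_H3] and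
   [cochain_gt3].

   So every bidegree but (1, m) is free of the predicted rank ([triangle_iso]), while the one at (1,
   m) is killed by [m]. This identifies the torsion of the direct sum, and [dim_tensor_rat_surj]
   turns the ranks into rational dimensions. *)
Require Import Defs.
From HB Require Import structures.
From mathcomp Require Import all_boot all_order all_algebra.
From mathcomp Require Import boolp.
From mathcomp Require Import zify ring.

Set Implicit Arguments.
Unset Strict Implicit.
Unset Printing Implicit Defensive.

Import GRing.Theory Num.Theory.
Local Open Scope ring_scope.
Local Open Scope quotient_scope.

(** * Rational dimension of an abelian group *)

Section TensorRat.
Variables (M : zmodType) (T : finType) (phi : {additive M -> {ffun T -> int}}).

Lemma additive_torsion (W : lmodType rat) (f : {additive M -> W}) x :
  torsion M x -> f x = 0.
Proof.
case=> n n_gt0 xn; have /eqP : f x *+ n = 0 by rewrite -raddfMn xn raddf0.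
by rewrite -scaler_nat scaler_eq0 pnatr_eq0 eqn0Ngt n_gt0 => /eqP.
Qed.

(** The universal map is [phi] followed by the inclusion of Z^T in Q^T. An additive [f] to a
    rational space extends by its values on lifts [s] of the basis vectors: [x] differs from the
    combination of lifts with the same image by an element of the kernel, which is torsion and hence
    killed by [f]. *)
Lemma dim_tensor_rat_surj :
    (forall y, exists x, phi x = y) -> (forall x, phi x = 0 -> torsion M x) ->
  dim_tensor_rat M #|T|.
Proof.
move=> phi_surj phi_ker.
pose delta (i : T) : {ffun T -> int} := [ffun k => (k == i)%:R].
have /boolp.choice[s sP] : forall i, exists x, phi x = delta i by move=> i.
pose iota x : 'rV[rat]_#|T| := \row_i (phi x (enum_val i))%:~R.
have iotaB : zmod_morphism iota.
  by move=> x y; apply/rowP => i; rewrite !mxE raddfB !ffunE rmorphB.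
pose iotaM := GRing.isZmodMorphism.Build _ _ iota iotaB.
pose iotaA : {additive M -> 'rV[rat]_#|T|} := HB.pack iota iotaM.
exists 'rV[rat]_#|T|, iotaA; split; last by rewrite dimvf /dim /= mul1n.
have iota_s i : iota (s (enum_val i)) = delta_mx 0 i.
  apply/rowP => k; rewrite !mxE sP ffunE (inj_eq enum_val_inj) eqxx /=.
  by case: (k == i).
move=> W; split=> [f|g1 g2 g12 v]; last first.
  rewrite (row_sum_delta v) !linear_sum; apply: eq_bigr => i _.
  rewrite !linearZ_LR -iota_s; congr (_ *: _); apply: g12.
pose g (v : 'rV[rat]_#|T|) := \sum_i v 0 i *: f (s (enum_val i)).
have gL : linear g.
  move=> a u v; rewrite /g scaler_sumr -big_split; apply: eq_bigr => i _ /=.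
  by rewrite !mxE scalerDl scalerA.
pose gM := GRing.isLinear.Build rat _ _ _ g gL.
pose gl : {linear 'rV[rat]_#|T| -> W} := HB.pack g gM.
exists gl => x; rewrite /= /g.
pose y := \sum_(i < #|T|) s (enum_val i) *~ phi x (enum_val i).
have phi_y : phi y = phi x.
  apply/ffunP => k; rewrite raddf_sum sum_ffunE (bigD1 (enum_rank k)) //=.
  rewrite enum_rankK raddfMz sP ffunMzE ffunE eqxx intz big1 ?addr0 // => i ik.
  rewrite raddfMz sP ffunMzE ffunE -{1}[k]enum_rankK (inj_eq enum_val_inj).
  by rewrite eq_sym (negbTE ik) mul0rz.
have /eqP : f (x - y) = 0.
  by apply/additive_torsion/phi_ker; rewrite raddfB phi_y subrr.
rewrite raddfB subr_eq0 => /eqP ->; rewrite raddf_sum.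
by apply: eq_bigr => i _; rewrite mxE raddfMz scaler_int.
Qed.

End TensorRat.

(** * Bigraded cohomology via homogeneous cocycles *)

Lemma cochain_homogeneousB (m : nat) (G : graph) (i j : nat)
    (u v : cochain m G i) :
  (forall s, homogeneous j (u s)) -> (forall s, homogeneous j (v s)) ->
  forall s, homogeneous j ((u - v) s).
Proof.
move=> uj vj s a; rewrite dprodBE !ffunE => uv.
have [ua|ua] := eqVneq (u s a) 0; last exact: uj ua.
by apply: (vj s a); apply: contraNneq uv => va; rewrite ua va subrr.
Qed.

Section BigradedIso.
Variables (m : nat) (G : graph) (i j : nat) (W : zmodType).
Variable Phi : {additive cochain m G i -> W}.

(** Each class of degree [j] has a homogeneous representative. Two of them differ by a homogeneous
    cocycle that is a coboundary, so the value of [Phi] does not depend on the choice. *)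
Lemma bigraded_iso :
    (forall z : cochain m G i, differential z = 0 ->
       (forall s, homogeneous j (z s)) -> (Phi z = 0 <-> in_image z)) ->
    (forall w, exists z : cochain m G i,
       [/\ differential z = 0, forall s, homogeneous j (z s) & Phi z = w]) ->
  exists f : {additive bigraded_cohomology m G i j -> W}, bijective f.
Proof.
move=> Phi_ker Phi_surj.
pose H := bigraded_cohomology m G i j.
pose is_rep (h : H) (z : cocycle m G i) :=
  (forall s, homogeneous j ((z : cochain m G i) s)) /\
  \pi_(Quotient.quot (@is_coboundary m G i)) z = val h.
have /boolp.choice[rep repP] : forall h : H, exists z, is_rep h z.
  by move=> h; exact/asboolP/(valP h).
have cocycle_d (z : cocycle m G i) : differential (val z) = 0.
  by apply/eqP; exact: (valP z).
have Phi_rep (h : H) z : is_rep h z -> Phi (val (rep h)) = Phi (val z).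
  case=> zj zh; have [rj rh] := repP h.
  apply/eqP; rewrite -subr_eq0 -raddfB; apply/eqP.
  apply/Phi_ker; [by rewrite raddfB /= !cocycle_d subrr|exact: cochain_homogeneousB|].
  have : rep h - z \in @is_coboundary m G i.
    by rewrite Quotient.idealrBE; apply/eqP; rewrite rh zh.
  by move/asboolP.
pose f (h : H) := Phi (val (rep h)).
have fB : zmod_morphism f.
  move=> h k; rewrite /f -raddfB -[RHS](Phi_rep (h - k) (rep h - rep k)) //.
  have [[hj hE] [kj kE]] := (repP h, repP k).
  by split; [exact: cochain_homogeneousB|rewrite !raddfB /= hE kE].
pose fM := GRing.isZmodMorphism.Build _ _ f fB.
pose fA : {additive H -> W} := HB.pack f fM.
have f_inj : injective fA.
  apply: raddf_inj => h fh; have [hj hE] := repP h.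
  have /(Phi_ker _ (cocycle_d _) hj) zb : Phi (val (rep h)) = 0 by [].
  have zI : rep h - 0 \in @is_coboundary m G i by rewrite subr0; apply/asboolP.
  apply: val_inj; rewrite -hE.
  rewrite -[RHS](raddf0 \pi_(Quotient.quot (@is_coboundary m G i))).
  by apply/eqP; rewrite -Quotient.idealrBE.
have /boolp.choice[g gK] : forall w, exists h, fA h = w.
  move=> w; have [z [dz zj zw]] := Phi_surj w.
  have zC : z \in @is_cocycle m G i by apply/eqP.
  pose c := Cocycle zC.
  have cH : \pi_(Quotient.quot (@is_coboundary m G i)) c
      \in @cohomology_degree m G i j by apply/asboolP; exists c.
  exists (BigradedCohomology cH); rewrite -zw; apply: (Phi_rep _ c).
  by split.
by exists fA, g => // h; apply: f_inj; rewrite gK.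
Qed.

End BigradedIso.

(** * Monomials in tensor powers *)

Section Monomials.
Variables (m : nat) (m_gt0 : (0 < m)%N).

Lemma coef_algA_X_exp n k : (k < m)%N ->
  (algA_X m ^+ n : {poly int})`_k = (k == n)%:R.
Proof.
move=> km; have [nm|mn] := ltnP n m; first by rewrite algA_XnE // coefXn.
rewrite nth_default; first by case: eqP => // kn; lia.
suff -> : algA_X m ^+ n = 0 by rewrite polyseq0.
rewrite -(subnKC mn) exprD.
suff -> : algA_X m ^+ m = 0 by rewrite mul0r.
rewrite /algA_X -[LHS]rmorphXn; apply: val_inj => /=.
by rewrite mk_monic_Xn prednK // Pdiv.RingMonic.rmodpp ?monicXn.
Qed.

(** Exponents are unbounded natural numbers, so that they can be added freely; the monomial is zero
    when one of them reaches [m]. *)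
Definition mono (I : finType) (F : I -> nat) : tpow m I :=
  tens (fun i => algA_X m ^+ F i).

Lemma monoE (I : finType) (F : I -> nat) (b : {ffun I -> 'I_m}) :
  mono F b = [forall i, b i == F i :> nat]%:R.
Proof.
rewrite ffunE; under eq_bigr => i _ do rewrite coef_algA_X_exp //.
have [/forallP bF|/forallPn[i biF]] := boolP [forall i, b i == F i :> nat].
  by rewrite big1 // => i _; rewrite bF.
by rewrite (bigD1 i) //= (negbTE biF) mul0r.
Qed.

Lemma mono_eq0 (I : finType) (F : I -> nat) i : (m <= F i)%N -> mono F = 0.
Proof.
move=> Fi; apply/ffunP => b; rewrite monoE ffunE.
case: forallP => // /(_ i) /eqP bi; have := ltn_ord (b i).
by rewrite bi ltnNge Fi.
Qed.

Lemma mono_homogeneous (I : finType) (F : I -> nat) :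
  homogeneous (\sum_i F i) (mono F).
Proof.
move=> b; rewrite monoE; case: forallP => // bF _.
by apply: eq_bigr => i _; apply/eqP.
Qed.

Lemma tpow_mul_mono (I J : finType) (p : I -> J) (F : I -> nat) :
  tpow_mul p (mono F) = mono (fun j => \sum_(i | p i == j) F i)%N.
Proof.
rewrite tpow_mul_tens //; congr tens; apply/funext => j.
by rewrite expr_sum.
Qed.

(** Written as a pairing with [mono F], the coordinate makes sense for every [F] and is 0 when an
    exponent is out of range. *)
Definition mono_coord (I : finType) (F : I -> nat) (x : tpow m I) : int :=
  \sum_(b : {ffun I -> 'I_m}) mono F b * x b.

Lemma coord_is_additive (I : finType) (F : I -> nat) :
  zmod_morphism (mono_coord F).
Proof.
move=> x y; rewrite /mono_coord -sumrB; apply: eq_bigr => b _.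
by rewrite !ffunE mulrBr.
Qed.

HB.instance Definition _ (I : finType) (F : I -> nat) :=
  GRing.isZmodMorphism.Build (tpow m I) int (mono_coord F) (coord_is_additive F).

Lemma coord_ffun (I : finType) (b : {ffun I -> 'I_m}) (x : tpow m I) :
  mono_coord (fun i => b i) x = x b.
Proof.
rewrite /mono_coord (bigD1 b) //= monoE (introT forallP) // mul1r.
rewrite big1 ?addr0 // => c.
rewrite monoE; case: forallP => [cb|_ _]; last by rewrite mul0r.
by case/eqP; apply/ffunP => i; apply/val_inj/eqP/cb.
Qed.

Lemma coord_eq0 (I : finType) (F : I -> nat) i (x : tpow m I) :
  (m <= F i)%N -> mono_coord F x = 0.
Proof.
by move=> Fi; rewrite /mono_coord (mono_eq0 Fi) big1 // => b _; rewrite ffunE mul0r.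
Qed.

Lemma coord_lt (I : finType) (F : I -> nat) (x : tpow m I) :
  (forall i, (F i < m)%N) ->
  exists b : {ffun I -> 'I_m}, F = (fun i => val (b i)) /\ mono_coord F x = x b.
Proof.
move=> Fm; pose b := [ffun i => Ordinal (Fm i)].
have FE : F = (fun i => val (b i)) by apply/funext => i; rewrite ffunE.
by exists b; split => //; rewrite {1}FE coord_ffun.
Qed.

Lemma coord_mono (I : finType) (F F' : I -> nat) :
  mono_coord F (mono F') = [forall i, (F i == F' i) && (F i < m)%N]%:R.
Proof.
have [/forallP Fm|/forallPn[i]] := boolP [forall i, (F i < m)%N]; last first.
  rewrite -leqNgt => Fi; rewrite (coord_eq0 _ Fi); case: forallP => // /(_ i).
  by rewrite ltnNge Fi andbF.
have [b [FE ->]] := coord_lt (mono F') Fm; rewrite monoE FE.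
by congr (_%:R); congr nat_of_bool; apply: eq_forallb => i; rewrite ltn_ord andbT.
Qed.

Lemma homogeneous_coord (I : finType) j (F : I -> nat) (x : tpow m I) :
  homogeneous j x -> mono_coord F x != 0 -> (\sum_i F i)%N = j.
Proof.
move=> xj; have [/forallP Fm|/forallPn[i]] := boolP [forall i, (F i < m)%N].
  by have [b [-> ->]] := coord_lt x Fm; apply: xj.
by rewrite -leqNgt => Fi; rewrite (coord_eq0 _ Fi) eqxx.
Qed.

End Monomials.

(** * Monomial cochains of a graph and their differentials *)

Section MonomialCochains.
Variables (m : nat) (m_gt0 : (0 < m)%N) (G : graph).
Implicit Types (s : {set 'I_(nedges G)}) (F : vertex G -> nat).

Lemma component_of_eq s u v :
  (component_of s u == component_of s v) = connect (adjacent s) u v.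
Proof.
by rewrite -val_eqE /= root_connect //; exact/sym_connect_sym/adjacent_sym.
Qed.

Lemma component_of_val s (c : component s) : component_of s (val c) = c.
Proof. by apply: val_inj; apply/eqP; exact: (valP c). Qed.

Lemma component_of_sub s s' u : s \subset s' ->
  component_of s' (val (component_of s u)) = component_of s' u.
Proof.
move=> ss'; apply/eqP; rewrite component_of_eq.
have : component_of s (val (component_of s u)) == component_of s u.
  by rewrite component_of_val.
rewrite component_of_eq; apply: connect_sub => x y /existsP[r /andP[rs rxy]].
by apply/connect1/existsP; exists r; rewrite (subsetP ss').
Qed.

(** The image in C^s of the monomial with exponent [F u] at each vertex [u]. In this form every
    per-edge map leaves [F] unchanged. *)
Definition vertex_mono s F : tpow m (component s) :=
  mono m (fun c => \sum_(u | component_of s u == c) F u)%N.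

Lemma edge_map_vertex_mono s s' F : s \subset s' ->
  edge_map s' (vertex_mono s F) = vertex_mono s' F.
Proof.
move=> ss'; rewrite /edge_map /vertex_mono tpow_mul_mono //.
congr mono; apply/funext => c'.
rewrite [RHS](partition_big (component_of s)
  (fun c => component_of s' (val c) == c')) /=; last first.
  by move=> u; rewrite component_of_sub.
apply: eq_bigr => c /eqP cc'; apply: eq_bigl => u.
rewrite andbC; case: eqP => //= uc.
by rewrite -(component_of_sub u ss') uc cc' eqxx.
Qed.

Lemma vertex_mono_homogeneous s F :
  homogeneous (\sum_u F u) (vertex_mono s F).
Proof.
rewrite (partition_big (component_of s) predT) //=.
exact: mono_homogeneous.
Qed.

Definition cell i (s : edge_subset G i) F : cochain m G i :=
  fun s' : edge_subset G i => if s' == s then vertex_mono (val s') F else 0.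

Lemma cellE i (s : edge_subset G i) F : cell s F s = vertex_mono (val s) F.
Proof. by rewrite /cell eqxx. Qed.

Lemma cell_neq i (s s' : edge_subset G i) F : s' != s -> cell s F s' = 0.
Proof. by rewrite /cell => /negbTE ->. Qed.

Lemma cell_homogeneous i (s s' : edge_subset G i) F :
  homogeneous (\sum_u F u) (cell s F s').
Proof.
rewrite /cell; case: ifP => _; first exact: vertex_mono_homogeneous.
by move=> a; rewrite ffunE eqxx.
Qed.

Lemma differential_cell i (s : edge_subset G i) F (s' : edge_subset G i.+1) :
  differential (cell s F) s' =
    \sum_(r | (r \notin val s) && (val s' == r |: val s))
      vertex_mono (val s') F *~ (-1) ^+ #|[set t in val s | (t < r)%N]|.
Proof.
rewrite /differential (bigD1 s) //= [X in _ + X]big1 ?addr0 => [|t ts].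
  apply: eq_bigr => r /andP[_ /eqP s'E].
  by rewrite cellE edge_map_vertex_mono // s'E subsetUr.
by apply: big1 => r _; rewrite cell_neq // raddf0 mul0rz.
Qed.

End MonomialCochains.

(** * The cochain complex of the triangle *)

Section TriangleComponents.

(** The vertex opposite to the edge [r], whose ends are [r] and [ordS r]. *)
Definition ordSS (r : 'I_3) : 'I_3 := ordS (ordS r).

Lemma triangle_component_none (u v : 'I_3) :
  (@component_of triangle set0 u == @component_of triangle set0 v) = (u == v).
Proof.
rewrite component_of_eq; apply/idP/eqP => [uv|->]; last exact: connect0.
have cl : closed (@adjacent triangle set0) (pred1 u).
  by move=> x y /existsP[r]; rewrite inE.
by have := closed_connect cl uv; rewrite !inE eqxx => /esym/eqP.
Qed.

Lemma triangle_component_edge (r u v : 'I_3) :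
  (@component_of triangle [set r] u == @component_of triangle [set r] v) =
  ((u == ordSS r) == (v == ordSS r)).
Proof.
rewrite component_of_eq; apply/idP/eqP => uv.
  have cl : closed (@adjacent triangle [set r]) (pred1 (ordSS r)).
    move=> x y /existsP[r']; rewrite inE => /andP[/eqP ->].
    case/orP => /eqP[<- <-]; rewrite !inE;
      by case: r {uv} => [[|[|[|//]]] ?].
  by have := closed_connect cl uv; rewrite !inE.
have [->|uv'] := eqVneq u v; first exact: connect0.
apply/connect1/existsP; exists r; rewrite inE eqxx /=.
by move: r u v uv uv' => [[|[|[|//]]] ?] [[|[|[|//]]] ?] [[|[|[|//]]] ?].
Qed.

Lemma triangle_component_large (s : {set 'I_3}) (u v : 'I_3) : (1 < #|s|)%N ->
  @component_of triangle s u = @component_of triangle s v.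
Proof.
move=> s1; apply/eqP; rewrite component_of_eq.
have sC : (#|~: s| <= 1)%N by have := cardsC s; rewrite card_ord; lia.
have ed r : r \in s -> connect (@adjacent triangle s) r (ordS r).
  move=> rs; apply/connect1/existsP; exists r.
  by rewrite rs eqxx.
have sym := sym_connect_sym (@adjacent_sym triangle s).
(* At most the edge [t] is missing; the other two form the path [ordS t], [ordSS t], [t] through all
   vertices. *)
have [t st] : exists t : 'I_3, forall r, r != t -> r \in s.
  have [/existsP[t ts]|] := boolP [exists t, t \notin s].
    exists t => r; apply: contraNT => rs.
    by move/card_le1P: sC => /(_ t) ; rewrite inE => /(_ ts r); rewrite !inE rs.
  by move/existsPn => st; exists ord0 => r _; have := st r; rewrite negbK.
have c1 : connect (@adjacent triangle s) (ordS t) (ordSS t).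
  by apply/ed/st; case: t {st} => [[|[|[|//]]] ?].
have c2 : connect (@adjacent triangle s) (ordSS t) t.
  have {2}-> : t = ordS (ordSS t).
    by apply: val_inj; case: t {st c1} => [[|[|[|//]]] ?].
  by apply/ed/st; case: t {st c1} => [[|[|[|//]]] ?].
have tC w : connect (@adjacent triangle s) w t.
  have : w \in [:: t; ordS t; ordSS t].
    by move: t w {st c1 c2} => [[|[|[|//]]] ?] [[|[|[|//]]] ?].
  rewrite !inE => /or3P[] /eqP ->; [exact: connect0| |exact: c2].
  exact: connect_trans c1 c2.
by rewrite (connect_trans (tC u)) // sym.
Qed.

End TriangleComponents.

Definition edge_exps (r : 'I_3) (a b : nat) :
    @component triangle [set r] -> nat :=
  fun k => if k == @component_of triangle [set r] r then a else b.
Arguments edge_exps : clear implicits.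

(** The sum may start at any vertex, so that an edge [r] finds its two ends first and the opposite
    vertex last. *)
Lemma sum_ord3 (r : 'I_3) (P : pred 'I_3) (F : 'I_3 -> nat) :
  (\sum_(u | P u) F u =
    P r * F r + P (ordS r) * F (ordS r) + P (ordSS r) * F (ordSS r))%N.
Proof.
pose g k := (P (inord k) * F (inord k))%N.
have gE (u : 'I_3) : (P u * F u)%N = g (val u) by rewrite /g inord_val.
rewrite big_mkcond; under eq_bigr => u _ do rewrite -mulnbl gE.
rewrite !gE !big_ord_recl big_ord0.
clearbody g; case: r => [[|[|[|//]]] ?];
  [change (g 0 + (g 1 + (g 2 + 0)) = g 0 + g 1 + g 2)%N
  |change (g 0 + (g 1 + (g 2 + 0)) = g 1 + g 2 + g 0)%N
  |change (g 0 + (g 1 + (g 2 + 0)) = g 2 + g 0 + g 1)%N]; lia.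
Qed.

Lemma ordS_neq (r : 'I_3) : (ordS r == r = false) * (r == ordSS r = false) *
  (ordS r == ordSS r = false) * (ordSS r == r = false) * (r == ordS r = false).
Proof. by case: r => [[|[|[|//]]] ?]. Qed.

Lemma sum_no_edge (F : 'I_3 -> nat) (k : @component triangle set0) :
  (\sum_(u | @component_of triangle set0 u == k) F u = F (val k))%N.
Proof.
rewrite (big_pred1 (val k)) // => u /=.
by rewrite -{1}[k]component_of_val triangle_component_none.
Qed.

Lemma sum_one_edge (r : 'I_3) (F : 'I_3 -> nat)
    (k : @component triangle [set r]) :
  (\sum_(u | @component_of triangle [set r] u == k) F u =
    edge_exps r (F r + F (ordS r)) (F (ordSS r)) k)%N.
Proof.
rewrite /edge_exps -[k]component_of_val triangle_component_edge.
under eq_bigl => u do rewrite triangle_component_edge.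
move: (val k : 'I_3) => v.
rewrite (sum_ord3 r) !ordS_neq eqxx.
by case: (v == ordSS r); rewrite /= ?mul0n ?mul1n ?addn0.
Qed.

Lemma dprod_sumE (K : Type) (M : K -> zmodType) (I : Type) (r : seq I)
    (P : pred I) (F : I -> dprod M) k :
  (\sum_(i <- r | P i) F i) k = \sum_(i <- r | P i) F i k.
Proof. by elim/big_rec2: _ => // i x y _ <-. Qed.

Lemma dprod_mulrzE (K : Type) (M : K -> zmodType) (x : dprod M) n k :
  (x *~ n) k = x k *~ n.
Proof.
have xn p : (x *+ p) k = x k *+ p.
  by elim: p => // p IH; rewrite !mulrS -IH.
case: n => n; first exact: xn.
exact: (congr1 -%R (xn n.+1)).
Qed.

Lemma dprodDE (K : Type) (M : K -> zmodType) (x y : dprod M) k :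
  (x + y) k = x k + y k.
Proof. by []. Qed.

Lemma dprodNE (K : Type) (M : K -> zmodType) (x : dprod M) k :
  (- x) k = - x k.
Proof. by []. Qed.

Lemma dprod_mulrnE (K : Type) (M : K -> zmodType) (x : dprod M) n k :
  (x *+ n) k = x k *+ n.
Proof. by rewrite !pmulrn dprod_mulrzE. Qed.

(** * The cells of the triangle and their boundaries *)

Section TriangleCochains.
Variables (m : nat) (m_gt0 : (0 < m)%N).
Implicit Types (r t u : 'I_3) (a b c n : nat).

Definition no_edge : edge_subset triangle 0 :=
  Sub (set0 : {set 'I_(nedges triangle)}) (introT eqP (cards0 _)).
Definition one_edge r : edge_subset triangle 1 :=
  Sub ([set r] : {set 'I_(nedges triangle)}) (introT eqP (cards1 r)).

Fact two_edges_subproof t : #|~: [set t]| == 2.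
Proof. by rewrite cardsC1 card_ord. Qed.
Definition two_edges t : edge_subset triangle 2 :=
  Sub (~: [set t] : {set 'I_(nedges triangle)}) (two_edges_subproof t).

Fact all_edges_subproof : #|[set: 'I_3]| == 3.
Proof. by rewrite cardsT card_ord. Qed.
Definition all_edges : edge_subset triangle 3 :=
  Sub ([set: 'I_3] : {set 'I_(nedges triangle)}) all_edges_subproof.

Lemma edge_subset0 (s : edge_subset triangle 0) : s = no_edge.
Proof. by apply: val_inj; apply/eqP; rewrite -cards_eq0 (valP s). Qed.

Lemma edge_subset1 (s : edge_subset triangle 1) : exists r, s = one_edge r.
Proof. by have /cards1P[r sr] := valP s; exists r; apply: val_inj. Qed.

Lemma edge_subset2 (s : edge_subset triangle 2) : exists t, s = two_edges t.
Proof.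
have /cards1P[t st] : #|~: (val s)| == 1.
  have := cardsC (val s); rewrite (eqP (valP s)) card_ord => sC.
  by rewrite -(eqn_add2l 2) sC.
by exists t; apply: val_inj; rewrite /= -st setCK.
Qed.

Lemma edge_subset3 (s : edge_subset triangle 3) : s = all_edges.
Proof.
apply: val_inj; apply/eqP; rewrite eqEcard subsetT.
by rewrite (eqP (valP s)) cardsT card_ord.
Qed.

Lemma edge_subset_gt3 i (s : edge_subset triangle i) : (i < 4)%N.
Proof. by have := max_card (mem (val s)); rewrite (eqP (valP s)) card_ord. Qed.

Definition vertex_exps a b c : 'I_3 -> nat := fun u => nth 0%N [:: a; b; c] u.

Definition vcell a b c : cochain m triangle 0 :=
  @cell m triangle 0 no_edge (vertex_exps a b c).

(* The exponent of x is a on the component of the edge r, and b on the        *)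
(* isolated vertex.                                                           *)
Definition ecell r a b : cochain m triangle 1 :=
  @cell m triangle 1 (one_edge r)
    (fun u => if u == r then a else if u == ordSS r then b else 0%N).

Definition pcell t n : cochain m triangle 2 :=
  @cell m triangle 2 (two_edges t) (vertex_exps n 0 0).

Lemma vertex_mono0E (F : 'I_3 -> nat) :
  @vertex_mono m triangle set0 F = mono m (fun k => F (val k)).
Proof. by congr mono; apply/funext => k; apply: sum_no_edge. Qed.

Lemma vertex_mono1E r (F : 'I_3 -> nat) :
  @vertex_mono m triangle [set r] F =
    mono m (edge_exps r (F r + F (ordS r)) (F (ordSS r))).
Proof. by congr mono; apply/funext => k; apply: sum_one_edge. Qed.

Lemma vertex_mono2E (s : {set 'I_3}) (F : 'I_3 -> nat) : (1 < #|s|)%N ->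
  @vertex_mono m triangle s F =
    mono m (fun=> F ord0 + F (ordS ord0) + F (ordSS ord0))%N.
Proof.
move=> s1; rewrite /vertex_mono; congr mono; apply/funext => k.
transitivity (\sum_(u : 'I_3) F u)%N.
  apply: eq_bigl => u; rewrite -[k]component_of_val.
  by rewrite (triangle_component_large u (val k : 'I_3) s1) eqxx.
by rewrite (sum_ord3 ord0) !mul1n.
Qed.

Lemma ecellE r a b : ecell r a b (one_edge r) = mono m (edge_exps r a b).
Proof. by rewrite /ecell cellE vertex_mono1E eqxx !ordS_neq addn0 eqxx. Qed.

Lemma pcellE t n : pcell t n (two_edges t) = mono m (fun=> n).
Proof.
rewrite /pcell cellE vertex_mono2E ?addn0 //.
by rewrite cardsC1 card_ord.
Qed.

Lemma ecell_neq r r' a b : r' != r -> ecell r a b (one_edge r') = 0.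
Proof.
move=> rr'; rewrite /ecell cell_neq // -val_eqE.
by apply: contra rr' => /eqP/set1_inj ->.
Qed.

Lemma pcell_neq t t' n : t' != t -> pcell t n (two_edges t') = 0.
Proof.
move=> tt'; rewrite /pcell cell_neq // -val_eqE; apply: contra tt' => /eqP /=.
by move/(can_inj (@setCK _))/set1_inj ->.
Qed.

Lemma ord3P r : [\/ r = ord0, r = ordS ord0 | r = ordSS ord0].
Proof.
case: r => [[|[|[|//]]] ?];
  [apply: Or31|apply: Or32|apply: Or33]; exact: val_inj.
Qed.

Lemma cochain_ext i (x y : cochain m triangle i) :
  (forall s, x s = y s) -> x = y.
Proof. exact: functional_extensionality_dep. Qed.

Lemma differential_vcell a b c : differential (vcell a b c) =
  ecell ord0 (a + b) c + ecell (ordS ord0) (b + c) a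
  + ecell (ordSS ord0) (c + a) b.
Proof.
apply: cochain_ext => s; have [r ->] := edge_subset1 s.
rewrite differential_cell // (bigD1 r) /=; last by rewrite !inE setU0 eqxx.
rewrite big1 ?addr0 => [|r' /andP[/andP[_]]]; last first.
  by rewrite setU0 => /eqP/set1_inj ->; rewrite eqxx.
rewrite (_ : [set _ in _ | _] = set0) ?cards0 ?expr0 ?mulr1z; last first.
  by apply/setP => x; rewrite !inE.
rewrite vertex_mono1E !dprodDE.
by have [] := ord3P r => ->; rewrite ecellE !ecell_neq // ?addr0 ?add0r /vertex_exps /=.
Qed.

Lemma two_edges_addl r r' t : (r' \notin [set r]) && (~: [set t] == r' |: [set r])
  = [&& r' != r, t != r & t != r'].
Proof.
rewrite inE; case: (eqVneq r' r) => //= r'r.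
apply/eqP/andP => [/setP tE|[tr tr']].
  by have := tE t; rewrite !inE eqxx => /esym/norP[].
apply/setP => x; rewrite !inE.
by case: r r' t x r'r tr tr' =>
  [[|[|[|//]]] ?] [[|[|[|//]]] ?] [[|[|[|//]]] ?] [[|[|[|//]]] ?].
Qed.

Lemma differential_ecell_sum r a b t : differential (ecell r a b) (two_edges t) =
  \sum_(r' | [&& r' != r, t != r & t != r'])
    mono m (fun=> (a + b)%N) *~ (-1) ^+ (r < r')%N.
Proof.
rewrite differential_cell //; apply: eq_big => r' /=; first exact: two_edges_addl.
move=> _; congr (_ *~ _ ^+ _).
  rewrite vertex_mono2E ?cardsC1 ?card_ord //; congr mono; apply/funext => k.
  case: (ord3P r) => -> /=; lia.
have [rr'|r'r] := ltnP r r'.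
  apply: etrans (cards1 r); apply: eq_card => x; rewrite !inE.
  by case: eqP => // ->.
apply: etrans (cards0 _); apply: eq_card => x; rewrite !inE.
by case: eqP => // ->; rewrite ltnNge r'r.
Qed.

(** The matrix of signs from edges [r] to pairs of edges, a pair being named by the edge [t] that it
    omits. The sign is -1 exactly when the added edge comes after [r]; the diagonal is 0 because the
    pair omitting [r] does not contain [r]. *)
Definition ecell_sign r t : int :=
  nth 0 (nth [::] [:: [:: 0; -1; -1]; [:: -1; 0; 1]; [:: 1; 1; 0]] r) t.

Lemma differential_ecell r a b t : differential (ecell r a b) (two_edges t) =
  mono m (fun=> (a + b)%N) *~ ecell_sign r t.
Proof.
rewrite differential_ecell_sum big_mkcond !big_ord_recl big_ord0.
by case: r t => [[|[|[|//]]] ?] [[|[|[|//]]] ?]; rewrite /= ?addr0 ?add0r.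
Qed.

Lemma differential_pcell t n : differential (pcell t n) all_edges =
  mono m (fun=> n) *~ (-1) ^+ (t : nat).
Proof.
rewrite differential_cell // (bigD1 t) /=; last first.
  by rewrite !inE eqxx /= setUCr.
rewrite vertex_mono2E ?cardsT ?card_ord // addn0 addn0 /=.
rewrite [X in _ + X]big1 ?addr0; last first.
  by move=> r /andP[/andP[]]; rewrite !inE negbK => /eqP ->; rewrite eqxx.
congr (_ *~ _ ^+ _).
by case: t => [[|[|[|//]]] t3];
  rewrite -sum1dep_card big_mkcond !big_ord_recl big_ord0 !inE.
Qed.

End TriangleCochains.

(** An identity of cochains is checked on integer coordinates. Cells are generalized to variables
    beforehand, so that they remain atoms for [ring]. *)
Ltac cochain_ring :=
  apply: cochain_ext => ?; apply/ffunP => ?;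
  rewrite ?(dprod_mulrnE, dprod_mulrzE, dprodDE, dprodNE);
  rewrite ?(ffunE, ffunMnE, ffunMzE) -?mulrzr; ring.

(** * Coordinates on the monomial cells *)

Section TriangleCoordinates.
Variables (m : nat) (m_gt0 : (0 < m)%N).
Implicit Types (r t u : 'I_3) (a b c n : nat).

Definition vcoord a b c (x : cochain m triangle 0) : int :=
  mono_coord (fun k => vertex_exps a b c (val k)) (x no_edge).

Definition ecoord r a b (x : cochain m triangle 1) : int :=
  mono_coord (edge_exps r a b) (x (one_edge r)).

Fact vcoord_is_additive a b c : zmod_morphism (vcoord a b c).
Proof. by move=> x y; rewrite /vcoord -raddfB. Qed.
HB.instance Definition _ a b c :=
  GRing.isZmodMorphism.Build (cochain m triangle 0) int (vcoord a b c)
    (vcoord_is_additive a b c).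

Fact ecoord_is_additive r a b : zmod_morphism (ecoord r a b).
Proof. by move=> x y; rewrite /ecoord -raddfB. Qed.
HB.instance Definition _ r a b :=
  GRing.isZmodMorphism.Build (cochain m triangle 1) int (ecoord r a b)
    (ecoord_is_additive r a b).

Lemma forall_component (s : {set 'I_3}) (P : pred (@component triangle s)) :
  [forall k, P k] = [forall u : 'I_3, P (@component_of triangle s u)].
Proof.
apply/forallP/forallP => [Pk u|Pu k]; first exact: Pk.
by rewrite -[k]component_of_val; exact: Pu.
Qed.

Lemma forall_ord3 (P : pred 'I_3) r :
  [forall u, P u] = [&& P r, P (ordS r) & P (ordSS r)].
Proof.
apply/forallP/and3P => [Pu|[P0 P1 P2] u]; first by split; apply: Pu.
have : u \in [:: r; ordS r; ordSS r].
  by move: r u {P0 P1 P2} => [[|[|[|//]]] ?] [[|[|[|//]]] ?].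
by rewrite !inE => /or3P[] /eqP ->.
Qed.

Lemma no_edge_val u : val (@component_of triangle set0 u) = u.
Proof.
by apply/eqP; rewrite -triangle_component_none component_of_val.
Qed.

Lemma vcoord_vcell a b c a' b' c' : vcoord a b c (vcell m a' b' c') =
  [&& a == a', b == b', c == c', a < m, b < m & c < m]%N%:R.
Proof.
rewrite /vcoord /vcell cellE vertex_mono0E // coord_mono // forall_component.
rewrite (forall_ord3 _ ord0) !no_edge_val /vertex_exps /=.
by congr ((nat_of_bool _)%:R); lia.
Qed.

Lemma edge_exps_of r a b u : edge_exps r a b (@component_of triangle [set r] u) =
  if u == ordSS r then b else a.
Proof.
rewrite /edge_exps triangle_component_edge [r == ordSS r]ordS_neq.
by case: (u == ordSS r).
Qed.

Lemma ecoord_ecell r a b r' a' b' : ecoord r a b (ecell m r' a' b') =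
  [&& r == r', a == a', b == b', a < m & b < m]%N%:R.
Proof.
rewrite /ecoord; have [<-|rr'] := eqVneq r r'; last first.
  by rewrite ecell_neq // raddf0.
rewrite ecellE // coord_mono // forall_component.
rewrite (forall_ord3 _ r) !edge_exps_of !ordS_neq eqxx.
by congr ((nat_of_bool _)%:R); lia.
Qed.

Lemma vcoord_eq0 a b c x : (m <= a)%N || (m <= b)%N || (m <= c)%N ->
  vcoord a b c x = 0.
Proof.
have := @coord_eq0 _ m_gt0 _ (fun k => vertex_exps a b c (val k)) _ (x no_edge).
move=> H; case/orP => [/orP[]|] mab.
- by apply: (H (@component_of triangle set0 ord0)); rewrite no_edge_val.
- by apply: (H (@component_of triangle set0 (ordS ord0))); rewrite no_edge_val.
by apply: (H (@component_of triangle set0 (ordSS ord0))); rewrite no_edge_val.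
Qed.

Lemma sum_vertex_exps a b c :
  (\sum_(k : @component triangle set0) vertex_exps a b c (val k) = a + b + c)%N.
Proof.
transitivity (\sum_(u : 'I_3) vertex_exps a b c u)%N.
  rewrite [RHS](partition_big (@component_of triangle set0) predT) //=.
  by apply: eq_bigr => k _; rewrite sum_no_edge.
by rewrite (sum_ord3 ord0) !mul1n.
Qed.

Lemma sum_edge_exps r a b :
  (\sum_(k : @component triangle [set r]) edge_exps r a b k = a + b)%N.
Proof.
pose F u := if u == r then a else if u == ordSS r then b else 0%N.
transitivity (\sum_(u : 'I_3) F u)%N.
  rewrite [RHS](partition_big (@component_of triangle [set r]) predT) //=.
  by apply: eq_bigr => k _; rewrite sum_one_edge /F eqxx !ordS_neq eqxx addn0.
by rewrite (sum_ord3 r) !mul1n /F eqxx !ordS_neq eqxx addn0.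
Qed.

Lemma homogeneous_vcoord j a b c (x : cochain m triangle 0) :
  (forall s, homogeneous j (x s)) -> vcoord a b c x != 0 -> (a + b + c)%N = j.
Proof.
by move=> /(_ no_edge) xj /(homogeneous_coord m_gt0 xj); rewrite sum_vertex_exps.
Qed.

Lemma homogeneous_ecoord j r a b (x : cochain m triangle 1) :
  (forall s, homogeneous j (x s)) -> ecoord r a b x != 0 -> (a + b)%N = j.
Proof.
move=> /(_ (one_edge r)) xj /(homogeneous_coord m_gt0 xj).
by rewrite sum_edge_exps.
Qed.

Lemma ecoord_val r (x : cochain m triangle 1)
    (d : {ffun component (val (one_edge r)) -> 'I_m}) :
  x (one_edge r) d = ecoord r (d (@component_of triangle [set r] r))
    (d (@component_of triangle [set r] (ordSS r))) x.
Proof.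
rewrite -(coord_ffun m_gt0) /ecoord; congr mono_coord; apply/funext => k.
rewrite -[k]component_of_val edge_exps_of; case: eqP => [->//|/eqP kr].
congr (nat_of_ord (d _)); apply/eqP.
by rewrite triangle_component_edge (negbTE kr) [r == _]ordS_neq.
Qed.

Lemma vcoord_val (x : cochain m triangle 0)
    (d : {ffun component (val no_edge) -> 'I_m}) :
  x no_edge d = vcoord (d (@component_of triangle set0 ord0))
    (d (@component_of triangle set0 (ordS ord0)))
    (d (@component_of triangle set0 (ordSS ord0))) x.
Proof.
rewrite -(coord_ffun m_gt0) /vcoord; congr mono_coord; apply/funext => k.
rewrite -[k]component_of_val no_edge_val.
by case: (ord3P (val k : 'I_3)) => ->.
Qed.

Lemma ecoord_ext (x y : cochain m triangle 1) :
  (forall r a b, (a < m)%N -> (b < m)%N -> ecoord r a b x = ecoord r a b y) ->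
  x = y.
Proof.
move=> xy; apply: cochain_ext => s; have [r ->] := edge_subset1 s.
by apply/ffunP => d; rewrite !ecoord_val xy.
Qed.

Lemma vcoord_ext (x y : cochain m triangle 0) :
  (forall a b c, (a < m)%N -> (b < m)%N -> (c < m)%N ->
     vcoord a b c x = vcoord a b c y) ->
  x = y.
Proof.
move=> xy; apply: cochain_ext => s; rewrite (edge_subset0 s).
by apply/ffunP => d; rewrite !vcoord_val xy.
Qed.

Lemma ecoord_sum r a b (I : Type) (s : seq I) (P : pred I)
    (F : I -> cochain m triangle 1) :
  ecoord r a b (\sum_(i <- s | P i) F i) = \sum_(i <- s | P i) ecoord r a b (F i).
Proof. exact: raddf_sum. Qed.

Lemma ecoordMz r a b x (n : int) : ecoord r a b (x *~ n) = ecoord r a b x * n.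
Proof. by rewrite -mulrzz; exact: raddfMz. Qed.

Lemma vcoord_sum a b c (I : Type) (s : seq I) (P : pred I)
    (F : I -> cochain m triangle 0) :
  vcoord a b c (\sum_(i <- s | P i) F i) = \sum_(i <- s | P i) vcoord a b c (F i).
Proof. exact: raddf_sum. Qed.

Lemma vcoordMz a b c x (n : int) : vcoord a b c (x *~ n) = vcoord a b c x * n.
Proof. by rewrite -mulrzz; exact: raddfMz. Qed.

Lemma differential_sum i (I : Type) (s : seq I) (P : pred I)
    (F : I -> cochain m triangle i) :
  differential (\sum_(k <- s | P k) F k) = \sum_(k <- s | P k) differential (F k).
Proof. exact: raddf_sum. Qed.

Lemma differentialMz i (x : cochain m triangle i) (n : int) :
  differential (x *~ n) = differential x *~ n.
Proof. exact: raddfMz. Qed.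

Lemma sum_ecoord_delta (f : 'I_3 -> nat -> nat -> int) r a b :
    (a < m)%N -> (b < m)%N ->
  \sum_r' \sum_(a' < m) \sum_(b' < m)
    [&& r == r', a == a', b == b', a < m & b < m]%N%:R * f r' a' b' = f r a b.
Proof.
move=> am bm.
rewrite (bigD1 r isT) (bigD1 (Ordinal am) isT) (bigD1 (Ordinal bm) isT) /=.
rewrite !eqxx am bm mul1r !big1 ?addr0 // => [i ir|i ia|i ib].
- by do 2![rewrite big1 // => ? _]; rewrite eq_sym (negbTE ir) mul0r.
- rewrite big1 // => ? _; rewrite (_ : (a == i) = false) ?andbF ?mul0r //.
  by rewrite eq_sym; exact: negbTE ia.
rewrite (_ : (b == i) = false) ?andbF ?mul0r //.
by rewrite eq_sym; exact: negbTE ib.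
Qed.

Lemma sum_vcoord_delta (f : nat -> nat -> nat -> int) a b c :
    (a < m)%N -> (b < m)%N -> (c < m)%N ->
  \sum_(a' < m) \sum_(b' < m) \sum_(c' < m)
    [&& a == a', b == b', c == c', a < m, b < m & c < m]%N%:R * f a' b' c'
  = f a b c.
Proof.
move=> am bm cm.
rewrite (bigD1 (Ordinal am) isT) (bigD1 (Ordinal bm) isT) (bigD1 (Ordinal cm) isT) /=.
rewrite !eqxx am bm cm mul1r !big1 ?addr0 // => [i ia|i ib|i ic].
- do 2![rewrite big1 // => ? _]; rewrite (_ : (a == i) = false) ?andbF ?mul0r //.
  by rewrite eq_sym; exact: negbTE ia.
- rewrite big1 // => ? _; rewrite (_ : (b == i) = false) ?andbF ?mul0r //.
  by rewrite eq_sym; exact: negbTE ib.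
rewrite (_ : (c == i) = false) ?andbF ?mul0r //.
by rewrite eq_sym; exact: negbTE ic.
Qed.

Opaque ecoord vcoord.

Lemma ecell_expand (x : cochain m triangle 1) :
  x = \sum_r \sum_(a < m) \sum_(b < m) ecell m r a b *~ ecoord r a b x.
Proof.
apply: ecoord_ext => r a b am bm.
rewrite -[LHS](sum_ecoord_delta (fun r a b => ecoord r a b x) r am bm).
rewrite [RHS]ecoord_sum; apply: eq_bigr => r' _.
rewrite [RHS]ecoord_sum; apply: eq_bigr => a' _.
rewrite [RHS]ecoord_sum; apply: eq_bigr => b' _.
by rewrite [RHS]ecoordMz ecoord_ecell.
Qed.

Lemma vcell_expand (x : cochain m triangle 0) :
  x = \sum_(a < m) \sum_(b < m) \sum_(c < m) vcell m a b c *~ vcoord a b c x.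
Proof.
apply: vcoord_ext => a b c am bm cm.
rewrite -[LHS](sum_vcoord_delta (fun a b c => vcoord a b c x) am bm cm).
rewrite [RHS]vcoord_sum; apply: eq_bigr => a' _.
rewrite [RHS]vcoord_sum; apply: eq_bigr => b' _.
rewrite [RHS]vcoord_sum; apply: eq_bigr => c' _.
by rewrite [RHS]vcoordMz vcoord_vcell.
Qed.

End TriangleCoordinates.

(* Unifying two different cochains would otherwise unfold coordinates down to *)
(* polynomial arithmetic.                                                     *)
Opaque ecoord vcoord.

Section Sums.
Variables (m n k : nat).

Lemma sum_delta (f : nat -> int) : (k < m)%N ->
  \sum_(c < m) (c == k :> nat)%:R * f c = f k.
Proof.
move=> km; rewrite (bigD1 (Ordinal km)) //= eqxx mul1r big1 ?addr0 // => c ck.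
by rewrite (_ : _ == _ = false) ?mul0r //; exact: negbTE ck.
Qed.

(** Since [n < m], the whole antidiagonal lies in the square of admissible exponents. *)
Lemma sum_antidiagonal (f : nat -> nat -> int) : (n < m)%N ->
  \sum_(a < m) \sum_(b < m) (a + b == n)%N%:R * f a b =
  \sum_(i < n.+1) f i (n - i)%N.
Proof.
move=> nm; rewrite (big_ord_widen_cond m predT (fun i => f i (n - i)%N)) //.
rewrite [RHS]big_mkcond; apply: eq_bigr => a _ /=; rewrite ltnS.
case: leqP => [an|na]; last first.
  by rewrite big1 // => b _; rewrite (_ : _ == _ = false) ?mul0r //; lia.
have bm : (n - a < m)%N by lia.
rewrite (bigD1 (Ordinal bm)) //= subnKC // eqxx mul1r big1 ?addr0 // => b.
rewrite -val_eqE /= => bn.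
by rewrite (_ : _ == _ = false) ?mul0r //; lia.
Qed.

End Sums.

(** * The first differential in coordinates *)

Section TriangleDifferential.
Variables (m : nat) (m_gt0 : (0 < m)%N).
Implicit Types (r t u : 'I_3) (a b c n : nat).

Lemma ecoordD r a b (x y : cochain m triangle 1) :
  ecoord r a b (x + y) = ecoord r a b x + ecoord r a b y.
Proof. exact: raddfD. Qed.

Lemma differential_expand (v : cochain m triangle 0) :
  differential v = \sum_(a < m) \sum_(b < m) \sum_(c < m)
    differential (vcell m a b c) *~ vcoord a b c v.
Proof.
rewrite {1}(vcell_expand m_gt0 v) [LHS]differential_sum; apply: eq_bigr => a _.
rewrite [LHS]differential_sum; apply: eq_bigr => b _.
rewrite [LHS]differential_sum; apply: eq_bigr => c _.
exact: differentialMz.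
Qed.

Lemma ecoord_differential r n k (v : cochain m triangle 0) :
  ecoord r n k (differential v) = \sum_(a < m) \sum_(b < m) \sum_(c < m)
    ecoord r n k (differential (vcell m a b c)) * vcoord a b c v.
Proof.
rewrite differential_expand [LHS]ecoord_sum; apply: eq_bigr => a _.
rewrite [LHS]ecoord_sum; apply: eq_bigr => b _.
rewrite [LHS]ecoord_sum; apply: eq_bigr => c _.
exact: ecoordMz.
Qed.

Lemma ecoord_differential_vcell r n k a b c : (n < m)%N -> (k < m)%N ->
  ecoord r n k (differential (vcell m a b c)) =
  [&& vertex_exps a b c r + vertex_exps a b c (ordS r) == n
    & vertex_exps a b c (ordSS r) == k]%N%:R.
Proof.
move=> nm km; rewrite differential_vcell // 2!ecoordD !(ecoord_ecell m_gt0).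
rewrite nm km !andbT.
by have [] := ord3P r => ->; rewrite /vertex_exps /= ?addr0 ?add0r;
  congr ((nat_of_bool _)%:R); lia.
Qed.

Variable v : cochain m triangle 0.

(** The edge 0 merges the first two factors, so the monomials that reach the exponents [n], [k] are
    those with first two exponents of sum [n] and third exponent [k]. Equating this and its two
    analogues to 0 gives the equations of the kernel. *)
Lemma ecoord0_differential n k : (n < m)%N -> (k < m)%N ->
  ecoord ord0 n k (differential v) = \sum_(i < n.+1) vcoord i (n - i) k v.
Proof.
move=> nm km; rewrite ecoord_differential.
rewrite -(sum_antidiagonal (fun i j => vcoord i j k v) nm).
apply: eq_bigr => a _; apply: eq_bigr => b _.
rewrite -(sum_delta (fun k => vcoord a b k v) km) mulr_sumr.
apply: eq_bigr => c _; rewrite ecoord_differential_vcell //.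
by rewrite mulrA -natrM mulnb.
Qed.

Lemma ecoord1_differential n k : (n < m)%N -> (k < m)%N ->
  ecoord (ordS ord0) n k (differential v) =
  \sum_(i < n.+1) vcoord k i (n - i) v.
Proof.
move=> nm km; rewrite ecoord_differential.
rewrite -(sum_delta (fun k => \sum_(i < n.+1) vcoord k i (n - i) v) km).
apply: eq_bigr => a _.
rewrite -(sum_antidiagonal (fun i j => vcoord a i j v) nm) mulr_sumr.
apply: eq_bigr => b _; rewrite mulr_sumr; apply: eq_bigr => c _.
rewrite ecoord_differential_vcell //.
by rewrite mulrA -natrM mulnb andbC.
Qed.

Lemma ecoord2_differential n k : (n < m)%N -> (k < m)%N ->
  ecoord (ordSS ord0) n k (differential v) =
  \sum_(i < n.+1) vcoord i k (n - i) v.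
Proof.
move=> nm km; rewrite ecoord_differential.
rewrite -(sum_antidiagonal (fun i j => vcoord i k j v) nm).
apply: eq_bigr => a _; rewrite exchange_big /=; apply: eq_bigr => c _.
rewrite -(sum_delta (fun k => vcoord a k c v) km) mulr_sumr.
apply: eq_bigr => b _; rewrite ecoord_differential_vcell //.
by rewrite mulrA -natrM mulnb /vertex_exps /= addnC.
Qed.

End TriangleDifferential.

(** * Degree 0 *)

Section Rigidity.
Variables (m : nat) (m_gt0 : (0 < m)%N) (V : nat -> nat -> nat -> int).
Hypothesis Vout :
  forall a b c, (m <= a)%N || (m <= b)%N || (m <= c)%N -> V a b c = 0.
Hypothesis V0 : forall n k, (n < m)%N -> (k < m)%N ->
  \sum_(i < n.+1) V i (n - i)%N k = 0.
Hypothesis V1 : forall n k, (n < m)%N -> (k < m)%N ->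
  \sum_(i < n.+1) V k i (n - i)%N = 0.
Hypothesis V2 : forall n k, (n < m)%N -> (k < m)%N ->
  \sum_(i < n.+1) V i k (n - i)%N = 0.
Hypothesis Vlarge : forall a b c, (0 < a)%N -> (1 < c)%N -> V a b c = 0.
Hypothesis Vlast : forall b, (0 < b)%N -> V m.-1 b 1 = 0.

Let V_a00 a : (a < m)%N -> V a 0 0 = 0.
Proof. by move=> am; have := V1 m_gt0 am; rewrite big_ord1. Qed.

Let V_0b0 b : (b < m)%N -> V 0 b 0 = 0.
Proof. by move=> bm; have := V2 m_gt0 bm; rewrite big_ord1. Qed.

Let V_ab0 a b : (0 < a < m)%N -> (b.+1 < m)%N -> V a b.+1 0 = - V a b 1.
Proof.
move=> /andP[a0 am] bm; have := V1 bm am.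
rewrite !big_ord_recr /= subnn (_ : b.+1 - b = 1)%N; last lia.
rewrite big1 => [|i _]; last by apply: Vlarge => //; have := ltn_ord i; lia.
by rewrite add0r addrC => /eqP; rewrite addr_eq0 => /eqP.
Qed.

Let V_0bc b c : (1 < c)%N -> V 0 b c = 0.
Proof.
move=> c1; have [bm|] := ltnP b m; last by move=> bm; apply: Vout; lia.
have [cm|] := ltnP c m; last by move=> cm; apply: Vout; lia.
have := V0 bm cm; rewrite big_ord_recl subn0 big1 ?addr0 // => i _.
exact: Vlarge.
Qed.

Let V_c_gt1 a b c : (1 < c)%N -> V a b c = 0.
Proof. by case: a => [|a] c1; [exact: V_0bc|exact: Vlarge]. Qed.

Let V_step0 p q : (0 < p)%N -> (p.+1 < m)%N -> (q < m)%N ->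
  V p.+1 q 0 = - V p q 1.
Proof.
move=> p0 pm qm; have := V2 pm qm; rewrite !big_ord_recr /= subnn subSnn.
rewrite big1 => [|i _]; last by apply: V_c_gt1; have := ltn_ord i; lia.
by rewrite add0r addrC => /eqP; rewrite addr_eq0 => /eqP.
Qed.

(** Both sides are the opposite of [V p.+1 q.+1 0]. So at height [c = 1] the family is constant
    along antidiagonals with [a > 0]. *)
Let V_step p q : (0 < p)%N -> (p.+1 < m)%N -> (q.+1 < m)%N ->
  V p q.+1 1 = V p.+1 q 1.
Proof.
move=> p0 pm qm; apply: oppr_inj.
by rewrite -V_step0 // V_ab0 // -ltnS ltnW.
Qed.

(** A short antidiagonal can be followed down to [b = 0], where [V_step0] compares the value with
    [V_a00]. *)
Let V_low a b : (0 < a)%N -> (a + b < m.-1)%N -> V a b 1 = 0.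
Proof.
elim: b a => [|b IH] a a0 ab; last first.
  by rewrite V_step ?IH //; lia.
by apply: oppr_inj; rewrite oppr0 -V_step0 ?V_a00 //; lia.
Qed.

(** A long antidiagonal ends at [a = m - 1] instead. For [n > 0] its value there is one of the
    coordinates assumed to vanish. *)
Let V_slide a b n : (0 < a)%N -> (b < m)%N -> (a + b = m.-1 + n)%N ->
  V a b 1 = V m.-1 n 1.
Proof.
elim: b a => [|b IH] a a0 bm ab.
  case: n ab => [|n] ab; first by have -> : a = m.-1 by lia.
  by rewrite Vlast // Vout //; lia.
have [am|am] := ltnP a.+1 m; last first.
  have [am'|am'] := ltnP a m; last by rewrite Vlast ?Vout //; lia.
  by have [-> ->] : a = m.-1 /\ b.+1 = n by lia.
by rewrite V_step ?IH //; lia.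
Qed.

(** On the antidiagonal [a + b = m - 1] all [m] values agree, the one at [a = 0] by [w2]. Their sum
    is 0 by [V0], so [m] times an integer is 0. *)
Let V_last : V m.-1 0 1 = 0.
Proof.
have [m1|m1] := leqP m 1; first by apply: Vout; lia.
have [m' mE] : exists m', m = m'.+2 by exists m.-2; lia.
have w2 : V 0 m.-1 1 = V m.-1 0 1.
  have := V2 m1 (_ : m.-1 < m)%N; rewrite !big_ord_recr big_ord0 /= add0r.
  rewrite subnn subn0 => /(_ ltac:(lia)).
  have -> : V 1 m.-1 0 = - V m.-1 0 1.
    rewrite {1}mE V_ab0; try lia.
    by rewrite (@V_slide 1 m' 0); lia.
  by move/eqP; rewrite subr_eq0 => /eqP.
have := V0 (_ : m.-1 < m)%N m1; rewrite big_ord_recl /= subn0 w2.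
move=> /(_ ltac:(lia)).
rewrite (eq_bigr (fun=> V m.-1 0 1)) => [|i _]; last first.
  by apply: V_slide => //=; have := ltn_ord i; rewrite /bump /=; lia.
rewrite sumr_const card_ord -mulrS => /eqP; rewrite mulrn_eq0 => /orP[|/eqP //].
by lia.
Qed.

Lemma rigidity a b c : V a b c = 0.
Proof.
have [out|] := boolP [|| m <= a, m <= b | m <= c]%N; first by apply: Vout; lia.
rewrite !negb_or -!ltnNge => /and3P[am bm cm].
have V_ab1 a' b' : (0 < a')%N -> V a' b' 1 = 0.
  move=> a'0; have [b'm|b'm] := ltnP b' m; last by apply: Vout; lia.
  have [ab|ab] := ltnP (a' + b') m.-1; first exact: V_low.
  rewrite (@V_slide a' b' (a' + b' - m.-1)) //; last lia.
  by case: (a' + b' - m.-1)%N => [|n]; [exact: V_last|exact: Vlast].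
case: c cm => [|[|c]] cm; last exact: V_c_gt1.
  case: a am => [|a] am; first exact: V_0b0.
  case: b bm => [|b] bm; first exact: V_a00.
  by rewrite V_ab0 // V_ab1 ?oppr0.
case: a am => [|a] am; last exact: V_ab1.
have := V0 bm cm; rewrite big_ord_recl subn0 big1 ?addr0 // => i _.
exact: V_ab1.
Qed.

End Rigidity.

(** * Explicit cocycles in the kernel *)

Section TriangleH0.
Variables (m : nat) (m_gt0 : (0 < m)%N).
Implicit Types (a b c n j p : nat).

Local Notation ecell2 := (ecell m (ordSS ord0)).

(* (x^a - y^a) y^b (z^c - y^c) *)
Definition path_cocycle a b c : cochain m triangle 0 :=
  vcell m a b c - vcell m 0 (a + b) c
  - (vcell m a (b + c) 0 - vcell m 0 (a + b + c) 0).

Lemma differentialB i (x y : cochain m triangle i) :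
  differential (x - y) = differential x - differential y.
Proof. exact: raddfB. Qed.

(** The polynomial vanishes for [x = y] and for [y = z], so only the edge between [z] and [x]
    contributes. *)
Lemma differential_path_cocycle a b c :
  differential (path_cocycle a b c) =
    ecell2 (a + c) b - ecell2 c (a + b)
    - (ecell2 a (b + c) - ecell2 0 (a + b + c)).
Proof.
rewrite /path_cocycle [LHS]differentialB.
rewrite [differential (vcell m a b c - _)]differentialB.
rewrite [differential (vcell m a (b + c) 0 - _)]differentialB.
rewrite !(differential_vcell m_gt0) !(add0n, addn0) addnA (addnC c a).
move: (ecell m ord0 _ c) (ecell m _ (b + c) a) (ecell2 (a + c) b)
  (ecell m _ (a + b + c) 0) (ecell2 c _) (ecell m ord0 _ 0) (ecell2 a _)
  (ecell2 0 _) => A B C D E F H K.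
cochain_ring.
Qed.

(* With Y_p := ecell2 p (j - p), the differential of path_cocycle a b c is    *)
(* Y_(a+c) - Y_c - Y_a + Y_0 for j = a + b + c. The sum below telescopes the  *)
(* case c = 1.                                                                *)
Definition path_cocycle_sum n j : cochain m triangle 0 :=
  \sum_(p < n) path_cocycle p (j - p.+1) 1.

Lemma differential_path_cocycle_sum n j : (n <= j)%N ->
  differential (path_cocycle_sum n j) =
    ecell2 n (j - n) - ecell2 0 j - (ecell2 1 j.-1 - ecell2 0 j) *+ n.
Proof.
rewrite /path_cocycle_sum [X in X = _]differential_sum.
elim: n => [|n IH] nj; first by rewrite big_ord0 subn0 mulr0n !subrr.
rewrite big_ord_recr /= IH; last exact: ltnW.
rewrite differential_path_cocycle.
rewrite addn1 (_ : n + (j - n.+1) = j.-1)%N; last lia.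
rewrite (_ : j - n.+1 + 1 = j - n)%N; last lia.
rewrite (_ : j.-1 + 1 = j)%N; last lia.
rewrite mulrSr.
move: (ecell2 n _) (ecell2 0 j) (ecell2 1 _) (ecell2 n.+1 _) => A B C D.
cochain_ring.
Qed.

Lemma ecell_eq0 r a b : (m <= a)%N || (m <= b)%N -> ecell m r a b = 0.
Proof.
move=> ab; apply: (ecoord_ext m_gt0) => r' a' b' am bm.
rewrite (ecoord_ecell m_gt0) [RHS](raddf0 (ecoord r' a' b')).
by rewrite (_ : [&& _, _, _, _ & _] = false) //; lia.
Qed.

Lemma vcoordB a b c (x y : cochain m triangle 0) :
  vcoord a b c (x - y) = vcoord a b c x - vcoord a b c y.
Proof. exact: raddfB. Qed.

Lemma vcoordD a b c (x y : cochain m triangle 0) :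
  vcoord a b c (x + y) = vcoord a b c x + vcoord a b c y.
Proof. exact: raddfD. Qed.

(** The other three monomials have exponent 0 at [x] or at [z]. *)
Lemma vcoord_path_cocycle a b c a' b' c' :
    (0 < a < m)%N -> (b < m)%N -> (0 < c < m)%N ->
  vcoord a b c (path_cocycle a' b' c') = [&& a == a', b == b' & c == c']%:R.
Proof.
move=> /andP[a0 am] bm /andP[c0 cm].
rewrite /path_cocycle [LHS]vcoordB.
rewrite [vcoord a b c (vcell m a' b' c' - _)]vcoordB.
rewrite [vcoord a b c (vcell m a' (b' + c') 0 - _)]vcoordB.
rewrite !(vcoord_vcell m_gt0) am bm cm !andbT.
by rewrite (gtn_eqF a0) (gtn_eqF c0) !andbF /= !subr0.
Qed.

Lemma vcoord_path_cocycle_sum n j a b c :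
    (0 < a < m)%N -> (b < m)%N -> (0 < c < m)%N ->
  vcoord a b c (path_cocycle_sum n j) = [&& a < n, b == j - a.+1 & c == 1]%N%:R.
Proof.
move=> am bm cm; rewrite /path_cocycle_sum [LHS]vcoord_sum.
have [an|na] /= := ltnP a n.
  rewrite (bigD1 (Ordinal an)) //= vcoord_path_cocycle // eqxx /=.
  rewrite big1 ?addr0 // => p /negbTE pa.
  by rewrite vcoord_path_cocycle // eq_sym [_ == _]pa.
rewrite big1 // => p _; rewrite vcoord_path_cocycle //.
by rewrite (_ : (a == p) = false) //; have := ltn_ord p; lia.
Qed.

(* When a + c >= m and j > m, the differential of the last sum is already 0,  *)
(* and omitting it keeps the coordinate at (m - 1, j - m, 1) equal to 0.      *)
Definition triangle_cocycle a b c : cochain m triangle 0 :=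
  let j := (a + b + c)%N in
  path_cocycle a b c + path_cocycle_sum a j + path_cocycle_sum c j
    - (if (a + c < m)%N || (j <= m)%N then path_cocycle_sum (a + c) j else 0).

Lemma differentialD i (x y : cochain m triangle i) :
  differential (x + y) = differential x + differential y.
Proof. exact: raddfD. Qed.

Lemma differential0 i : differential (0 : cochain m triangle i) = 0.
Proof. exact: raddf0. Qed.

(** The defect Y_(a+c) - Y_a - Y_c + Y_0 of the first term is cancelled by the sums, each of which
    replaces Y_n by Y_0 + n (Y_1 - Y_0). *)
Lemma triangle_cocycle_closed a b c : differential (triangle_cocycle a b c) = 0.
Proof.
rewrite /triangle_cocycle /=; set j := (a + b + c)%N.
have dD (x y z t : cochain m triangle 0) : differential (x + y + z - t) =
    differential x + differential y + differential z - differential t.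
  by rewrite differentialB !differentialD.
rewrite [LHS]dD {dD} differential_path_cocycle.
rewrite [differential (path_cocycle_sum a j)]differential_path_cocycle_sum; last lia.
rewrite [differential (path_cocycle_sum c j)]differential_path_cocycle_sum; last lia.
rewrite -/j (_ : j - a = b + c)%N; last lia.
rewrite (_ : j - c = a + b)%N; last lia.
case: ifPn => [_|].
  rewrite differential_path_cocycle_sum; last lia.
  rewrite (_ : j - (a + c) = b)%N; last lia.
  rewrite mulrnDr.
  move: (ecell2 (a + c) b) (ecell2 c _) (ecell2 a _) (ecell2 0 j) (ecell2 1 _).
  move=> A B C D E.
  cochain_ring.
rewrite negb_or -leqNgt -ltnNge => /andP[acm jm].
rewrite differential0.
rewrite (@ecell_eq0 _ (a + c)) ?acm // (@ecell_eq0 _ 0) ?(ltnW jm) ?orbT //.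
rewrite (@ecell_eq0 _ 1); last by lia.
move: (ecell2 c _) (ecell2 a _) => B C.
rewrite subrr mul0rn.
cochain_ring.
Qed.

(** For [j > m] each of Y_m, Y_0 and Y_1 has an exponent that is at least [m]. This cocycle is dual
    to the coordinate (m - 1, j - m, 1). *)
Lemma path_cocycle_sum_closed j : (m < j)%N ->
  differential (path_cocycle_sum m j) = 0.
Proof.
move=> jm; rewrite differential_path_cocycle_sum; last exact: ltnW.
rewrite (@ecell_eq0 _ m) ?leqnn // (@ecell_eq0 _ 0) ?(ltnW jm) ?orbT //.
rewrite (@ecell_eq0 _ 1); last by lia.
by rewrite subrr mul0rn subrr.
Qed.

End TriangleH0.

(** * The kernel as a free group on the chosen coordinates *)

Section TriangleH0Iso.
Variables (m : nat) (m_gt0 : (0 < m)%N) (j : nat).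
Implicit Types (a b c n p : nat).

(* The kernel of d^0 in degree j projects isomorphically onto these           *)
(* coordinates.                                                               *)
Definition h0_index_pred (e : 'I_m * 'I_m * 'I_m) : bool :=
  let a : nat := e.1.1 in let b : nat := e.1.2 in let c : nat := e.2 in
  [&& 0 < a, 0 < c, (1 < c) || (a == m.-1) && (0 < b) & a + b + c == j]%N.

Definition h0_index : finType := {e | h0_index_pred e}.

Definition h0_coord (v : cochain m triangle 0) : {ffun h0_index -> int} :=
  [ffun e : h0_index => vcoord (val e).1.1 (val e).1.2 (val e).2 v].

Fact h0_coord_is_additive : zmod_morphism h0_coord.
Proof. by move=> x y; apply/ffunP => e; rewrite !ffunE vcoordB. Qed.
HB.instance Definition _ :=
  GRing.isZmodMorphism.Build (cochain m triangle 0) {ffun h0_index -> int}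
    h0_coord h0_coord_is_additive.

Lemma h0_coord_inj (z : cochain m triangle 0) : differential z = 0 ->
  (forall s, homogeneous j (z s)) -> h0_coord z = 0 -> z = 0.
Proof.
move=> dz zj z0; apply: (vcoord_ext m_gt0) => a b c _ _ _.
rewrite [RHS](raddf0 (vcoord a b c)).
have z_out a' b' c' : (m <= a')%N || (m <= b')%N || (m <= c')%N ->
  vcoord a' b' c' z = 0 by exact: vcoord_eq0.
have zK a' b' c' : (0 < a')%N -> (0 < c')%N ->
    (1 < c')%N || (a' == m.-1) && (0 < b')%N -> vcoord a' b' c' z = 0.
  move=> a'0 c'0 abc.
  have [/z_out //|] := boolP ((m <= a') || (m <= b') || (m <= c'))%N.
  rewrite !negb_or -!ltnNge => /andP[/andP[a'm b'm] c'm].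
  apply/eqP/negPn/negP => /[dup] z_neq0 /(homogeneous_vcoord m_gt0 zj) abcj.
  have eP : h0_index_pred (Ordinal a'm, Ordinal b'm, Ordinal c'm).
    by rewrite /h0_index_pred /= a'0 c'0 abc abcj eqxx.
  have := congr1 (fun f : {ffun h0_index -> int} => f (Sub _ eP)) z0.
  by rewrite !ffunE /=; apply/eqP.
have ec0 r n k : ecoord r n k (differential z) = 0.
  by rewrite dz; exact: raddf0.
apply: (@rigidity m m_gt0 (fun a b c => vcoord a b c z)) => //.
- by move=> n k nm km; rewrite -ecoord0_differential.
- by move=> n k nm km; rewrite -ecoord1_differential.
- by move=> n k nm km; rewrite -ecoord2_differential.
- by move=> a' b' c' a'0 c'1; apply: zK => //; [exact: ltnW|rewrite c'1].
move=> b' b'0; have [m1|m1] := ltnP 1 m; last by apply: z_out; lia.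
by apply: zK => //; [lia|rewrite eqxx b'0 orbT].
Qed.

Lemma vcell_homogeneous a b c : (a + b + c)%N = j ->
  forall s, homogeneous j (vcell m a b c s).
Proof.
move=> <- s.
have := @cell_homogeneous m m_gt0 triangle 0 no_edge s (vertex_exps a b c).
by rewrite (sum_ord3 ord0 predT (vertex_exps a b c)) !mul1n.
Qed.

Let hc (z : cochain m triangle 0) := forall s, homogeneous j (z s).

Let hcB x y : hc x -> hc y -> hc (x - y).
Proof. exact: cochain_homogeneousB. Qed.

Let hc0 : hc 0.
Proof. by move=> s a; rewrite ffunE eqxx. Qed.

Let hcD x y : hc x -> hc y -> hc (x + y).
Proof.
by move=> xj yj; rewrite -[y]opprK -[- y]add0r; apply: hcB => //; exact: hcB.
Qed.

Let hc_path a b c : (a + b + c)%N = j -> hc (path_cocycle m a b c).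
Proof.
move=> abc; apply: hcB; apply: hcB; apply: vcell_homogeneous; lia.
Qed.

Let hc_path_sum n : (n <= j)%N -> hc (path_cocycle_sum m n j).
Proof.
move=> nj; rewrite /path_cocycle_sum; elim/big_ind: _ => // p _.
by apply: hc_path; have := ltn_ord p; lia.
Qed.

Lemma h0_coord_delta (e : h0_index) : exists z : cochain m triangle 0,
  [/\ differential z = 0, forall s, homogeneous j (z s)
    & h0_coord z = [ffun e' => (e' == e)%:R]].
Proof.
case: e => [[[a b] c] eP]; have /and4P[/= a0 c0 abc /eqP jE] := eP.
have coordP (z : cochain m triangle 0) :
    (forall a' b' c' : 'I_m, h0_index_pred (a', b', c') ->
      vcoord a' b' c' z = [&& a' == a, b' == b & c' == c]%:R) ->
    h0_coord z = [ffun e' => (e' == exist _ (a, b, c) eP)%:R].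
  move=> zE; apply/ffunP => -[[[a' b'] c'] e'P]; rewrite !ffunE zE //.
  by rewrite -[exist _ _ _ == _]val_eqE /= !xpair_eqE andbA.
have am := ltn_ord a; have bm := ltn_ord b; have cm := ltn_ord c.
have [c1|c1] := ltnP 1 c.
  exists (triangle_cocycle m a b c); split; first exact: triangle_cocycle_closed.
    rewrite /triangle_cocycle jE; apply: hcB.
      apply: hcD; last by apply: hc_path_sum; lia.
      by apply: hcD; [exact: hc_path|apply: hc_path_sum; lia].
    by case: ifP => _ //; apply: hc_path_sum; lia.
  apply: coordP => a' b' c' /and4P[/= a'0 c'0 abc' /eqP jE'].
  have a'm := ltn_ord a'; have b'm := ltn_ord b'; have c'm := ltn_ord c'.
  rewrite /triangle_cocycle jE [LHS]vcoordB.
  have vD (x y z : cochain m triangle 0) : vcoord a' b' c' (x + y + z) =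
      vcoord a' b' c' x + vcoord a' b' c' y + vcoord a' b' c' z.
    by rewrite !vcoordD.
  rewrite vD vcoord_path_cocycle ?a'0 ?c'0 //.
  rewrite !vcoord_path_cocycle_sum ?a'0 ?c'0 //.
  (* An index with [c' = 1] has [a' = m - 1] and [b' > 0], hence [j > m]. A sum of [n] terms reaches
     it only if [n >= m], which is the case where [triangle_cocycle] omits its last sum. *)
  have sum0 n : (n < m)%N || ((a + c < m)%N || (j <= m)%N) && (n == a + c)%N ->
      [&& a' < n, b' == j - a'.+1 :> nat & c' == 1 :> nat]%N = false.
    by clear -abc' jE jE' a'm b'm c'm c1 a0; lia.
  rewrite (sum0 a) ?am // (sum0 c) ?cm //.
  case: ifP => [cond|_]; last first.
    by rewrite (raddf0 (vcoord a' b' c')) !addr0.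
  rewrite vcoord_path_cocycle_sum ?a'0 ?c'0 //.
  by rewrite sum0 ?cond ?eqxx ?orbT // !addr0.
(* Here [c = 1], so [a = m - 1] and [j = m + b > m]. *)
exists (path_cocycle_sum m m j); split.
- by apply: path_cocycle_sum_closed => //; lia.
- by apply: hc_path_sum; lia.
apply: coordP => a' b' c' /and4P[/= a'0 c'0 abc' /eqP jE'].
have a'm := ltn_ord a'; have b'm := ltn_ord b'; have c'm := ltn_ord c'.
rewrite vcoord_path_cocycle_sum ?a'0 ?c'0 // -!val_eqE /=.
by congr ((nat_of_bool _)%:R); lia.
Qed.

Theorem triangle_H0 :
  exists f : {additive bigraded_cohomology m triangle 0 j ->
    {ffun h0_index -> int}}, bijective f.
Proof.
apply: (@bigraded_iso m triangle 0 j _ h0_coord).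
  move=> z dz zj; split => [|->]; first exact: h0_coord_inj.
  exact: (raddf0 h0_coord).
have /boolp.choice[z zP] := h0_coord_delta.
move=> w; exists (\sum_e z e *~ w e); split.
- rewrite [LHS]differential_sum big1 // => e _.
  by rewrite differentialMz; case: (zP e) => -> _ _; rewrite mul0rz.
- have hcMn x n : hc x -> hc (x *+ n).
    by move=> xj; elim: n => // n IH; rewrite mulrS; exact: hcD.
  elim/big_ind: _ => // e _; case: (zP e) => _ zj _.
  case: (w e) => n; first exact: hcMn.
  by rewrite NegzE mulrNz -[- _]add0r; apply: hcB => //; exact: hcMn.
have h0Mz x (n : int) : h0_coord (x *~ n) = h0_coord x *~ n by exact: raddfMz.
rewrite [LHS](raddf_sum h0_coord); apply/ffunP => e.
rewrite sum_ffunE (bigD1 e) //= h0Mz ffunMzE; case: (zP e) => _ _ ->.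
rewrite ffunE eqxx intz big1 ?addr0 // => e' e'e.
rewrite h0Mz ffunMzE; case: (zP e') => _ _ ->.
by rewrite ffunE eq_sym (negbTE e'e) mul0rz.
Qed.

End TriangleH0Iso.

(** * Degree 1 *)

Section TriangleH1.
Variables (m : nat) (m_gt0 : (0 < m)%N).
Implicit Types (r : 'I_3) (a b c n p j : nat).

(* Modulo coboundaries, degree j cocycles are multiples of                    *)
(* x (x) x^(j-1) - 1 (x) x^j on the edge 1. The class of a cocycle is its     *)
(* multiplier, read off by x^a (x) x^b |-> a on the edge 1 and |-> - b on the *)
(* edges 0 and 2.                                                             *)
Definition h1_weight r a b : int := nth 0 [:: - b%:Z; a%:Z; - b%:Z] r.

Definition h1_class j (x : cochain m triangle 1) : int :=
  \sum_r \sum_(a < m) \sum_(b < m)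
    (a + b == j)%N%:R * h1_weight r a b * ecoord r a b x.

Fact h1_class_is_additive j : zmod_morphism (h1_class j).
Proof.
move=> x y; rewrite /h1_class -sumrB; apply: eq_bigr => r _.
rewrite -sumrB; apply: eq_bigr => a _; rewrite -sumrB; apply: eq_bigr => b _.
by rewrite -mulrBr; congr (_ * _); exact: raddfB.
Qed.
HB.instance Definition _ j :=
  GRing.isZmodMorphism.Build (cochain m triangle 1) int (h1_class j)
    (h1_class_is_additive j).

Lemma h1_class_ecell j r a b : h1_class j (ecell m r a b) =
  [&& a < m, b < m & a + b == j]%N%:R * h1_weight r a b.
Proof.
have [/andP[am bm]|] := boolP ((a < m) && (b < m))%N; last first.
  rewrite negb_and -!leqNgt => abm; rewrite ecell_eq0 // (raddf0 (h1_class j)).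
  by rewrite (_ : [&& _, _ & _] = false) ?mul0r //; lia.
rewrite am bm /=; pose f r' a' b' := (a' + b' == j)%N%:R * h1_weight r' a' b'.
rewrite -[RHS](sum_ecoord_delta f r am bm); apply: eq_bigr => r' _.
apply: eq_bigr => a' _; apply: eq_bigr => b' _.
rewrite -/(f r' a' b') (ecoord_ecell m_gt0) mulrC am bm !ltn_ord !andbT.
by rewrite (eq_sym r) (eq_sym a) (eq_sym b).
Qed.

Lemma h1_classE j x : h1_class j x = \sum_r \sum_(a < m) \sum_(b < m)
  (a + b == j)%N%:R * h1_weight r a b * ecoord r a b x.
Proof. by []. Qed.

Opaque h1_class.

Lemma h1_classD j (x y : cochain m triangle 1) :
  h1_class j (x + y) = h1_class j x + h1_class j y.
Proof. exact: raddfD. Qed.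

Lemma h1_classB j (x y : cochain m triangle 1) :
  h1_class j (x - y) = h1_class j x - h1_class j y.
Proof. exact: raddfB. Qed.

Lemma h1_classMz j (x : cochain m triangle 1) (n : int) :
  h1_class j (x *~ n) = h1_class j x * n.
Proof. by rewrite -mulrzz; exact: raddfMz. Qed.

Lemma h1_class_sum j (I : Type) (s : seq I) (P : pred I)
    (F : I -> cochain m triangle 1) :
  h1_class j (\sum_(i <- s | P i) F i) = \sum_(i <- s | P i) h1_class j (F i).
Proof. exact: raddf_sum. Qed.

Lemma h1_class_differential_vcell j a b c :
    (a < m)%N -> (b < m)%N -> (c < m)%N -> (j <= m)%N ->
  exists2 n : int,
    h1_class j (differential (vcell m a b c)) = n * m & (j < m)%N -> n = 0.
Proof.
move=> am bm cm jm; rewrite differential_vcell // 2!h1_classD !h1_class_ecell.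
rewrite am bm cm /= /h1_weight /=.
rewrite (_ : (a + b + c == j)%N = (a + (b + c) == j)%N); last lia.
rewrite (_ : (b + c + a == j)%N = (a + (b + c) == j)%N); last lia.
rewrite (_ : (c + a + b == j)%N = (a + (b + c) == j)%N); last lia.
have [abc|_] := eqVneq (a + (b + c))%N j; last first.
  by exists 0; rewrite // !andbF !mul0r.
(* The three weights - c, b + c and - b cancel. Since [j <= m], the only truncation that matters is
   [b + c = m], [a = 0]: the term on the edge 1 disappears and - m remains. *)
rewrite !andbT; exists (if (j == m) && (a == 0%N) then -1 else 0); last first.
  by move=> jlt; rewrite (ltn_eqF jlt).
have [bcm|bcm] := ltnP (b + c)%N m; have [abm|abm] := ltnP (a + b)%N m;
  have [cam|cam] := ltnP (c + a)%N m; rewrite ?mul1r ?mul0r ?add0r ?addr0;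
  case: ifP => H; rewrite ?mulN1r ?mul0r; lia.
Qed.

Lemma h1_class_differential j (v : cochain m triangle 0) : (j <= m)%N ->
  exists2 n : int, h1_class j (differential v) = n * m & (j < m)%N -> n = 0.
Proof.
move=> jm.
have /boolp.choice[f fP] : forall e : 'I_m * 'I_m * 'I_m, exists n : int,
    h1_class j (differential (vcell m e.1.1 e.1.2 e.2)) = n * m /\
    ((j < m)%N -> n = 0).
  by case=> [[a b] c]; have [n ? ?] := @h1_class_differential_vcell j a b c
    (ltn_ord _) (ltn_ord _) (ltn_ord _) jm; exists n.
exists (\sum_(a < m) \sum_(b < m) \sum_(c < m) f (a, b, c) * vcoord a b c v).
  rewrite (differential_expand m_gt0) [LHS]h1_class_sum mulr_suml.
  apply: eq_bigr => a _.
  rewrite [LHS]h1_class_sum mulr_suml; apply: eq_bigr => b _.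
  rewrite [LHS]h1_class_sum mulr_suml; apply: eq_bigr => c _.
  by rewrite [LHS]h1_classMz; have [-> _] := fP (a, b, c); rewrite mulrAC.
move=> jlt; rewrite big1 // => a _; rewrite big1 // => b _.
rewrite big1 // => c _.
by have [_ ->] := fP (a, b, c); rewrite ?mul0r.
Qed.

Definition coboundary1 : {pred cochain m triangle 1} :=
  fun x => `[< exists v : cochain m triangle 0, differential v = x >].

Fact coboundary1_closed : zmod_closed coboundary1.
Proof.
split=> [|x y /asboolP[u <-] /asboolP[v <-]]; apply/asboolP.
  by exists 0; exact: differential0.
by exists (u - v); exact: differentialB.
Qed.

HB.instance Definition _ :=
  GRing.isZmodClosed.Build (cochain m triangle 1) coboundary1 coboundary1_closed.

Lemma coboundary1D x y :
  x \in coboundary1 -> y \in coboundary1 -> x + y \in coboundary1.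
Proof. exact: rpredD. Qed.

Lemma coboundary1_eq x y : x = y -> x \in coboundary1 -> y \in coboundary1.
Proof. by move=> ->. Qed.

Lemma coboundary1B x y :
  x \in coboundary1 -> y \in coboundary1 -> x - y \in coboundary1.
Proof. exact: rpredB. Qed.

Lemma differential_coboundary1 v : differential v \in coboundary1.
Proof. by apply/asboolP; exists v. Qed.

Local Notation "x ~ y" := (x - y \in coboundary1) (at level 70).

Lemma coboundary1_trans (x y z : cochain m triangle 1) : x ~ y -> y ~ z -> x ~ z.
Proof.
move=> xy yz; rewrite (_ : x - z = (x - y) + (y - z)); first exact: rpredD.
by cochain_ring.
Qed.

Definition h1_gen j : cochain m triangle 1 :=
  ecell m (ordS ord0) 1 j.-1 - ecell m (ordS ord0) 0 j.

(** This is Y_p = p Y_1, by induction from Y_(p+1) = Y_p + Y_1. *)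
Lemma ecell1_cob p q : ecell m (ordS ord0) p q ~
  h1_gen (p + q) *~ p + ecell m (ordS ord0) 0 (p + q).
Proof.
elim: p q => [|p IH] q.
  by rewrite mulr0z add0r add0n subrr; exact: rpred0.
have := IH q.+1; rewrite addnS -addSn; set j := (p.+1 + q)%N => IH'.
(* As a polynomial this is x^q (y - x) (z^p - x^p), which vanishes for [x = y] and for [z = x]; only
   the edge 1 sees it. *)
have := differential_coboundary1 (vcell m q 1 p - vcell m (q + 1) 0 p
  - (vcell m (p + q) 1 0 - vcell m (p + q + 1) 0 0)).
have dD (x y z t : cochain m triangle 0) : differential (x - y - (z - t)) =
    differential x - differential y - (differential z - differential t).
  by rewrite !differentialB.
rewrite dD !differential_vcell // !addn0 !add0n.
rewrite !addn1 add1n (_ : p + q.+1 = j)%N /j ?addSnnS // -addSnnS -/j.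
rewrite /h1_gen (_ : j.-1 = p + q)%N; last by rewrite /j; lia.
move: IH'; rewrite /h1_gen (_ : j.-1 = p + q)%N; last by rewrite /j; lia.
move: (ecell m (ordS ord0) p.+1 q) (ecell m (ordS ord0) p q.+1)
  (ecell m (ordS ord0) 1 (p + q)) (ecell m (ordS ord0) 0 j)
  (ecell m ord0 q.+1 p) (ecell m ord0 j 0) (ecell m (ordSS ord0) j 0)
  (ecell m (ordSS ord0) (p + q) 1) => A B C D E F H K IH1 dH.
by apply: coboundary1_eq (coboundary1D IH1 dH); cochain_ring.
Qed.

Lemma ecell2_cob a b : ecell m (ordSS ord0) a b ~
  ecell m (ordSS ord0) (a + b) 0 - h1_gen (a + b) *~ b.
Proof.
have := differential_coboundary1 (vcell m a b 0 - vcell m (a + b) 0 0).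
rewrite differentialB !differential_vcell // !addn0 !add0n.
have := ecell1_cob b a; rewrite (addnC b).
move: (h1_gen _) (ecell m ord0 _ _) (ecell m _ b a) (ecell m _ a b)
  (ecell m (ordS ord0) 0 _) (ecell m (ordSS ord0) (a + b) 0) => A B C D E F H1 H2.
by apply: coboundary1_eq (coboundary1B H2 H1); cochain_ring.
Qed.

Lemma ecell0_cob a b : ecell m ord0 a b ~
  - h1_gen (a + b) *~ b - ecell m (ordS ord0) 0 (a + b)
  - ecell m (ordSS ord0) (a + b) 0.
Proof.
have := differential_coboundary1 (vcell m a 0 b).
rewrite differential_vcell // !addn0 !add0n (addnC b).
have := ecell1_cob b a; rewrite (addnC b).
move: (h1_gen _) (ecell m ord0 _ _) (ecell m _ b a) (ecell m _ 0 _)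
  (ecell m _ _ 0) => A B C D E H1 H2.
by apply: coboundary1_eq (coboundary1B H2 H1); cochain_ring.
Qed.

(** For [j < m], the coefficient of x^j once the two factors on the edge [r] are multiplied, which
    is all that the next differential sees. *)
Definition antidiag_sum r j (z : cochain m triangle 1) : int :=
  \sum_(a < m) \sum_(b < m) (a + b == j)%N%:R * ecoord r a b z.

Lemma differential_expand1 (z : cochain m triangle 1) t :
  differential z (two_edges t) = \sum_r \sum_(a < m) \sum_(b < m)
    mono m (fun=> (a + b)%N) *~ (ecell_sign r t * ecoord r a b z).
Proof.
rewrite {1}(ecell_expand m_gt0 z) [differential _]differential_sum.
rewrite [LHS]dprod_sumE; apply: eq_bigr => r _.
rewrite [differential _]differential_sum [LHS]dprod_sumE; apply: eq_bigr => a _.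
rewrite [differential _]differential_sum [LHS]dprod_sumE; apply: eq_bigr => b _.
rewrite [differential _]differentialMz [LHS]dprod_mulrzE.
by rewrite differential_ecell // mulrzA.
Qed.

Lemma cocycle_antidiag_sum (z : cochain m triangle 1) n t :
    differential z = 0 -> (n < m)%N ->
  \sum_r ecell_sign r t * antidiag_sum r n z = 0.
Proof.
move=> dz nm; have := congr1 (fun x : cochain m triangle 2 => x (two_edges t)) dz.
rewrite /= differential_expand1 => /(congr1 (mono_coord (fun=> n))).
rewrite [RHS](raddf0 (mono_coord _)) => cz; rewrite -[RHS]cz {cz}.
rewrite [RHS](raddf_sum (mono_coord _)). apply: eq_bigr => r _.
rewrite [RHS](raddf_sum (mono_coord _)) mulr_sumr; apply: eq_bigr => a _.
rewrite [RHS](raddf_sum (mono_coord _)) mulr_sumr; apply: eq_bigr => b _.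
rewrite [RHS](raddfMz (mono_coord _)) /= -[RHS]mulrzr coord_mono // mulrCA.
rewrite intz (_ : [forall _, _] = (a + b == n)%N) //.
rewrite (eq_sym (a + b)%N) nm andbT; apply/forallP/eqP => [|-> //].
by move=> /(_ (@component_of triangle _ ord0)) /eqP.
Qed.

Lemma h1_reduction j (z : cochain m triangle 1) : differential z = 0 ->
  (forall s, homogeneous j (z s)) -> z ~ h1_gen j *~ h1_class j z.
Proof.
move=> dz zj.
pose e1 := ecell m (ordS ord0) 0 j; pose e2 := ecell m (ordSS ord0) j 0.
(* The remainders in [ecell0_cob], [ecell1_cob] and [ecell2_cob]; in degree [j] they depend only on
   the edge. *)
pose u (r : 'I_3) := nth 0 [:: - e1 - e2; e1; e2] r.
have cob r a b : (a + b)%N = j ->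
    ecell m r a b ~ h1_gen j *~ h1_weight r a b + u r.
  move=> abj; have [] := ord3P r => ->; rewrite /u /h1_weight /= -/e1 -/e2.
  - have := ecell0_cob a b; rewrite abj -/e1 -/e2.
    by rewrite mulrNz mulNrz addrA.
  - by have := ecell1_cob a b; rewrite abj.
  have := ecell2_cob a b; rewrite abj -/e1 -/e2.
  by rewrite mulrNz [_ + e2]addrC.
pose y := \sum_r \sum_(a < m) \sum_(b < m)
  (h1_gen j *~ h1_weight r a b + u r) *~ ((a + b == j)%N%:R * ecoord r a b z).
have zy : z ~ y.
  rewrite {1}(ecell_expand m_gt0 z) /y -[X in X \in _]sumrB; apply: rpred_sum => r _.
  rewrite -[X in X \in _]sumrB; apply: rpred_sum => a _.
  rewrite -[X in X \in _]sumrB; apply: rpred_sum => b _.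
  have [abj|abj] := eqVneq (a + b)%N j.
    by rewrite mul1r -mulrzBl; apply: rpredMz; exact: cob.
  rewrite mul0r mulr0z subr0; have [->|zr] := eqVneq (ecoord r a b z) 0.
    by rewrite mulr0z rpred0.
  by case/eqP: abj; exact: (homogeneous_ecoord m_gt0 zj zr).
apply: (coboundary1_trans zy).
suff -> : y = h1_gen j *~ h1_class j z.
  by rewrite subrr; exact: rpred0.
have yE : y = h1_gen j *~ h1_class j z + \sum_r u r *~ antidiag_sum r j z.
  rewrite h1_classE [X in X + _]mulrz_sumr -[RHS]big_split; apply: eq_bigr => r _ /=.
  rewrite [X in X + _]mulrz_sumr [X in _ + X]mulrz_sumr -[RHS]big_split.
  apply: eq_bigr => a _ /=.
  rewrite [X in X + _]mulrz_sumr [X in _ + X]mulrz_sumr -[RHS]big_split.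
  apply: eq_bigr => b _ /=.
  by rewrite mulrzDl -mulrzA; congr (_ *~ _ + _); ring.
suff W0 : \sum_r u r *~ antidiag_sum r j z = 0 by rewrite yE W0 addr0.
(* From degree [m] on, [e1] and [e2] are zero. Below it, the cocycle equations make the three
   antidiagonal sums equal, and the remainders add up to 0. *)
have cW t := @cocycle_antidiag_sum z j t dz; clear - m_gt0 cW.
have [mj|jm] := leqP m j.
  have e10 : e1 = 0 by apply: ecell_eq0 => //; rewrite mj orbT.
  have e20 : e2 = 0 by apply: ecell_eq0 => //; rewrite mj.
  have u0 r : u r = 0.
    by rewrite /u e10 e20 subr0 oppr0; case: (ord3P r) => ->.
  by apply: big1 => r _; rewrite u0 mul0rz.
have := cW (ordS ord0) jm; have := cW ord0 jm.
rewrite !big_ord_recl !big_ord0 /u /ecell_sign /=.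
have -> : lift ord0 (lift ord0 ord0) = ordSS ord0 :> 'I_3 by exact: val_inj.
move: (antidiag_sum (ordSS _) _ _) (antidiag_sum (lift _ _) _ _)
  (antidiag_sum ord0 _ _) => A B C.
move=> AB AC; have -> : A = B by lia.
have -> : C = B by lia.
by rewrite addr0 -opprD mulNrz mulrzDl addNr.
Qed.

Lemma h1_gen_closed j : (0 < j)%N -> differential (h1_gen j) = 0.
Proof.
move=> j0; rewrite /h1_gen [LHS]differentialB; apply/eqP; rewrite subr_eq0; apply/eqP.
apply: cochain_ext => s; have [t ->] := edge_subset2 s.
rewrite [LHS](differential_ecell m_gt0) [RHS](differential_ecell m_gt0).
by rewrite add1n prednK // add0n.
Qed.

Lemma ecell_homogeneous r a b s : homogeneous (a + b) (ecell m r a b s).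
Proof.
have := @cell_homogeneous m m_gt0 triangle 1 (one_edge r) s
  (fun u => if u == r then a else if u == ordSS r then b else 0%N).
by rewrite (sum_ord3 r) !mul1n eqxx !ordS_neq eqxx addn0.
Qed.

Lemma h1_gen_homogeneous j s : (0 < j)%N -> homogeneous j (h1_gen j s).
Proof.
move=> j0 a; rewrite /h1_gen dprodDE dprodNE !ffunE => h.
have [e1a|e1a] := eqVneq (ecell m (ordS ord0) 1 j.-1 s a) 0; last first.
  by rewrite (ecell_homogeneous e1a); lia.
apply: (@ecell_homogeneous (ordS ord0) 0 j s).
by apply: contraNneq h => e0a; rewrite e1a e0a subr0.
Qed.

Lemma h1_class_gen j : (0 < j <= m)%N -> (1 < m)%N -> h1_class j (h1_gen j) = 1.
Proof.
move=> /andP[j0 jm] m1; rewrite /h1_gen h1_classB !h1_class_ecell.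
rewrite /h1_weight /= mulr0 subr0 mulr1 m1.
by rewrite (_ : [&& _, _ & _] = true) //; lia.
Qed.

Lemma h1_gen_eq0 j : (m < j)%N -> h1_gen j = 0.
Proof.
move=> mj; rewrite /h1_gen !ecell_eq0 ?subrr //; lia.
Qed.

(** Y_m = m Y_1 in degree [m], and both monomials of Y_m contain x^m. *)
Lemma h1_gen_torsion : h1_gen m *~ m \in coboundary1.
Proof.
have := @ecell1_cob m 0; rewrite !addn0.
rewrite (ecell_eq0 m_gt0 _ (_ : (m <= m) || _)%N) ?leqnn //.
rewrite (ecell_eq0 m_gt0 _ (_ : _ || (m <= m))%N) ?leqnn ?orbT //.
by rewrite addr0 sub0r rpredN.
Qed.

(** All weights vanish in degree 0, and the generator itself is zero above degree [m]. *)
Lemma h1_trivial j (z : cochain m triangle 1) : (j == 0)%N || (m < j)%N ->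
  differential z = 0 -> (forall s, homogeneous j (z s)) -> in_image z.
Proof.
move=> jm dz zj; have := h1_reduction dz zj => zB.
suff yz : h1_gen j *~ h1_class j z = 0 by apply/asboolP; move: zB; rewrite yz subr0.
clear zB dz zj; case/orP: jm => [/eqP ->|mj].
  rewrite (_ : h1_class 0 z = 0) ?mulr0z // h1_classE.
  apply: big1 => r _; apply: big1 => a _; apply: big1 => b _.
  case: eqP => [ab|]; last by rewrite !mul0r.
  have [-> ->] : nat_of_ord a = 0%N /\ nat_of_ord b = 0%N by lia.
  by rewrite /h1_weight; case: (ord3P r) => -> /=; rewrite ?oppr0 mulr0 mul0r.
by rewrite h1_gen_eq0 // mul0rz.
Qed.

Lemma h1_free j (z : cochain m triangle 1) : (0 < j < m)%N ->
    differential z = 0 -> (forall s, homogeneous j (z s)) ->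
  h1_class j z = 0 <-> in_image z.
Proof.
move=> /andP[j0 jm] dz zj; have zB := h1_reduction dz zj; split=> [z0|[v <-]].
  by apply/asboolP; move: zB; rewrite z0 mulr0z subr0.
by have [n -> ->] := h1_class_differential v (ltnW jm); rewrite ?mul0r.
Qed.

Lemma h1_torsion (z : cochain m triangle 1) :
    differential z = 0 -> (forall s, homogeneous m (z s)) ->
  (exists n : int, h1_class m z = n * m) <-> in_image z.
Proof.
move=> dz zj; have zB := h1_reduction dz zj; split=> [[n zn]|[v <-]].
  apply/asboolP; move: zB; rewrite zn mulrC mulrzA => zB.
  have := coboundary1D zB (rpredMz n h1_gen_torsion).
  by rewrite subrK.
by have [n -> _] := h1_class_differential v (leqnn m); exists n.
Qed.

End TriangleH1.

(** * Degrees 2 and 3 *)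

Section TriangleH2H3.
Variables (m : nat) (m_gt0 : (0 < m)%N).
Implicit Types (r t : 'I_3) (n : nat).

Lemma coord_const (s : {set 'I_3}) n n' : (n < m)%N ->
  mono_coord (fun=> n) (mono m (fun=> n') : tpow m (@component triangle s)) =
  (n' == n)%:R.
Proof.
move=> nm; rewrite coord_mono // eq_sym.
congr ((nat_of_bool _)%:R); apply/forallP/eqP => [|-> k]; last by rewrite eqxx.
by move=> /(_ (@component_of triangle s ord0)) /andP[/eqP].
Qed.

(** With two or more edges there is one component, so exponent functions are constant. *)
Lemma expand_large (s : {set 'I_3}) (x : tpow m (@component triangle s)) :
    (1 < #|s|)%N ->
  x = \sum_(n < m) mono m (fun=> n : nat) *~ mono_coord (fun=> n : nat) x.
Proof.
move=> s1; apply/ffunP => b; rewrite sum_ffunE.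
pose n := b (@component_of triangle s ord0).
have bE : (fun k => b k : nat) = (fun=> n : nat).
  apply/funext => k; rewrite -[k]component_of_val /n.
  by rewrite (triangle_component_large (val k : 'I_3) ord0 s1).
rewrite (bigD1 n) //= ffunMzE -[mono _ _ b](coord_ffun m_gt0) bE coord_const //.
rewrite eqxx intz -[LHS](coord_ffun m_gt0) bE big1 ?addr0 // => k kn.
rewrite ffunMzE -[mono _ _ b](coord_ffun m_gt0) bE coord_const //.
by rewrite (_ : (k == n :> nat) = false) ?mul0rz //; exact: negbTE kn.
Qed.

Lemma triangle_H3 (z : cochain m triangle 3) : in_image z.
Proof.
exists (\sum_(n < m) pcell m ord0 n *~ mono_coord (fun=> n : nat) (z all_edges)).
apply: cochain_ext => s; rewrite (edge_subset3 s) [in LHS]differential_sum.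
rewrite [LHS]dprod_sumE [RHS]expand_large; last by rewrite cardsT card_ord.
apply: eq_bigr => n _; rewrite differentialMz [LHS]dprod_mulrzE.
by rewrite differential_pcell // expr0 mulr1z.
Qed.

Definition pcoord t n (z : cochain m triangle 2) : int :=
  mono_coord (fun=> n) (z (two_edges t)).

Lemma two_edges_gt1 t : (1 < #|~: [set t]|)%N.
Proof. by rewrite cardsC1 card_ord. Qed.

Lemma big_single (V : nmodType) (I : finType) (i : I) (F : I -> V) :
  (forall k, k != i -> F k = 0) -> \sum_k F k = F i.
Proof. by move=> F0; rewrite (bigD1 i) //= big1 ?addr0. Qed.

Lemma big_ord3 (V : nmodType) (F : 'I_3 -> V) :
  \sum_r F r = F ord0 + F (ordS ord0) + F (ordSS ord0).
Proof.
rewrite !big_ord_recl big_ord0 addr0 addrA.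
by congr (_ + F _ + F _); exact: val_inj.
Qed.

Lemma pcell_expand (z : cochain m triangle 2) :
  z = \sum_t \sum_(n < m) pcell m t n *~ pcoord t n z.
Proof.
apply: cochain_ext => s; have [t ->] := edge_subset2 s.
rewrite [RHS]dprod_sumE; rewrite (big_single (i := t)); last first.
  move=> t' tt'; rewrite [LHS]dprod_sumE; apply: big1 => n _.
  by rewrite [LHS]dprod_mulrzE pcell_neq 1?eq_sym //; exact: mul0rz.
rewrite [RHS]dprod_sumE [LHS]expand_large ?two_edges_gt1 //.
by apply: eq_bigr => n _; rewrite [RHS]dprod_mulrzE pcellE.
Qed.

Lemma cocycle_pcoord (z : cochain m triangle 2) n :
    differential z = 0 -> (n < m)%N ->
  pcoord ord0 n z - pcoord (ordS ord0) n z + pcoord (ordSS ord0) n z = 0.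
Proof.
move=> dz nm.
have dE : differential z all_edges = \sum_(t : 'I_3) \sum_(n < m)
    mono m (fun=> n : nat) *~ ((-1) ^+ (t : nat) * pcoord t n z).
  rewrite {1}(pcell_expand z) [differential _]differential_sum.
  rewrite [LHS]dprod_sumE; apply: eq_bigr => t _.
  rewrite [differential _]differential_sum [LHS]dprod_sumE; apply: eq_bigr => k _.
  rewrite [differential _]differentialMz [LHS]dprod_mulrzE.
  by rewrite differential_pcell // mulrzA.
have := congr1 (mono_coord (fun=> n)) dE; rewrite {}dz {dE}.
rewrite [X in X = _](raddf0 (mono_coord _)).
rewrite [X in _ = X](raddf_sum (mono_coord _)) /=.
have step (t : 'I_3) : mono_coord (fun=> n)
    (\sum_(n0 < m) mono m (fun=> n0 : nat) *~
      ((-1) ^+ (t : nat) * pcoord t n0 z) :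
        tpow m (@component triangle [set: 'I_3])) =
    (-1) ^+ (t : nat) * pcoord t n z.
  rewrite [LHS](raddf_sum (mono_coord _)).
  rewrite -[RHS](sum_delta (fun n => (-1) ^+ (t : nat) * pcoord t n z) nm).
  apply: eq_bigr => k _; rewrite [LHS](raddfMz (mono_coord _)) /= coord_const //.
  by rewrite -[LHS]mulrzr intz.
under eq_bigr do rewrite step.
rewrite big_ord3; have -> : (-1) ^+ (ord0 : 'I_3) = 1 :> int by [].
have -> : (-1) ^+ (ordS ord0 : 'I_3) = -1 :> int by [].
have -> : (-1) ^+ (ordSS ord0 : 'I_3) = 1 :> int by [].
by move: (pcoord ord0 n z) (pcoord (ordS ord0) n z) (pcoord (ordSS ord0) n z); lia.
Qed.

Lemma triangle_H2 (z : cochain m triangle 2) : differential z = 0 -> in_image z.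
Proof.
(* The edges 1 and 2 reach the pairs omitting 2 and 1 separately, each with sign +1. This fixes the
   coefficients; the pair omitting 0 then agrees by [cocycle_pcoord]. *)
move=> dz; exists (\sum_(n < m) (
  ecell m (ordS ord0) n 0 *~ pcoord (ordSS ord0) n z
  + ecell m (ordSS ord0) n 0 *~ pcoord (ordS ord0) n z)).
have cz n := @cocycle_pcoord z n dz; clear dz.
apply: cochain_ext => s; have [t ->] := edge_subset2 s.
rewrite [in LHS]differential_sum [LHS]dprod_sumE.
rewrite [RHS]expand_large ?two_edges_gt1 //.
apply: eq_bigr => n _; have zE := cz n (ltn_ord n); clear cz.
have dD (x y : cochain m triangle 1) : differential (x + y) (two_edges t) =
    differential x (two_edges t) + differential y (two_edges t).
  by rewrite differentialD.
have dE r (k : int) : differential (ecell m r n 0 *~ k) (two_edges t) =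
    mono m (fun=> n : nat) *~ (ecell_sign r t * k).
  by rewrite differentialMz [LHS]dprod_mulrzE differential_ecell // addn0 mulrzA.
rewrite [LHS]dD; apply: etrans (congr2 +%R (dE _ _) (dE _ _)) _.
rewrite -[LHS]mulrzDr; congr (_ *~ _).
rewrite -[RHS]/(pcoord t n z) {dE}.
have [] := ord3P t => tE; move: zE; rewrite tE /ecell_sign /=;
  move: (pcoord ord0 n z) (pcoord (ordS ord0) n z) (pcoord (ordSS ord0) n z); lia.
Qed.

Lemma cochain_gt3 i (x y : cochain m triangle i) : (3 < i)%N -> x = y.
Proof.
move=> i3; apply: cochain_ext => s; have := edge_subset_gt3 s.
by rewrite ltnNge i3.
Qed.

End TriangleH2H3.

(** * Ranks *)

Lemma leq_card_map (T T' : finType) (A : {pred T}) (B : {pred T'}) (f : T -> T') :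
  {in A &, injective f} -> {in A, forall x, f x \in B} -> (#|A| <= #|B|)%N.
Proof.
move=> /card_in_imset <- AB; apply/subset_leq_card/subsetP => _ /imsetP[x xA ->].
exact: AB.
Qed.

Section TriangleCard.
Variables (m : nat) (m_gt0 : (0 < m)%N) (j : nat).

Let I3 : finType := ('I_m * 'I_m * 'I_m)%type.
Let ord (k : nat) : 'I_m := insubd (Ordinal m_gt0) k.
Let ordE k : (k < m)%N -> ord k = k :> nat.
Proof. by move=> km; rewrite val_insubd km. Qed.

Let positive (e : I3) : bool :=
  [&& 0 < e.1.1, 0 < e.1.2, 0 < e.2 & e.1.1 + e.1.2 + e.2 == j]%N.

(** For [c < m - 1], moving one unit from [b] to [c] gives the indices with [c > 1] and [b < m - 1].
    Triples with [c = m - 1] fill the rest: [b > 1] gives those with [c > 1] and [b = m - 1], and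
    [b = 1] gives those with [c = 1]. *)
Let to_h0 (e : I3) : I3 :=
  let a : nat := e.1.1 in let b : nat := e.1.2 in let c : nat := e.2 in
  if (c.+1 < m)%N then (ord a, ord b.-1, ord c.+1)
  else if (1 < b)%N then (ord a, ord m.-1, ord b) else (ord m.-1, ord a, ord 1).

Let of_h0 (e : I3) : I3 :=
  let a : nat := e.1.1 in let b : nat := e.1.2 in let c : nat := e.2 in
  if (1 < c)%N then
    if (b.+1 < m)%N then (ord a, ord b.+1, ord c.-1) else (ord a, ord c, ord m.-1)
  else (ord b, ord 1, ord m.-1).

Lemma card_h0_index : #|h0_index m j| = #|[pred e | positive e]|.
Proof.
rewrite card_sig.
have I3_inj (e e' : I3) : (e.1.1 = e'.1.1 :> nat) -> (e.1.2 = e'.1.2 :> nat) ->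
    (e.2 = e'.2 :> nat) -> e = e'.
  by case: e e' => [[a b] c] [[a' b'] c'] /= /val_inj -> /val_inj -> /val_inj ->.
have toK : {in [pred e | positive e], cancel to_h0 of_h0}.
  move=> [[a b] c]; rewrite inE /positive /= => /and4P[a0 b0 c0 abc].
  have am := ltn_ord a; have bm := ltn_ord b; have cm := ltn_ord c.
  rewrite /to_h0 /=; case: (ltnP c.+1 m) => c1; [|case: (ltnP 1 b) => b1];
    rewrite /of_h0 /= !ordE; try lia; rewrite ?ltnS ?c0 ?b1 ?ltnn.
  - by rewrite (_ : (b.-1.+1 < m)%N); [apply: I3_inj; rewrite /= ordE; lia|lia].
  - by rewrite (_ : (m.-1.+1 < m)%N = false); [apply: I3_inj; rewrite /= ordE; lia|lia].
  by apply: I3_inj; rewrite /= ordE; lia.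
have ofK : {in [pred e | h0_index_pred j e], cancel of_h0 to_h0}.
  move=> [[a b] c]; rewrite inE /h0_index_pred /= => /and4P[a0 c0 ac abc].
  have am := ltn_ord a; have bm := ltn_ord b; have cm := ltn_ord c.
  rewrite /of_h0 /=; case: (ltnP 1 c) => c1; [case: (ltnP b.+1 m) => b1|];
    rewrite /to_h0 /= !ordE; try lia.
  - by rewrite (_ : (c.-1.+1 < m)%N); [apply: I3_inj; rewrite /= ordE; lia|lia].
  - rewrite (_ : (m.-1.+1 < m)%N = false) ?c1; last lia.
    by apply: I3_inj; rewrite /= ordE; lia.
  rewrite (_ : (m.-1.+1 < m)%N = false) ?ltnn; last lia.
  by apply: I3_inj; rewrite /= ordE; lia.
apply/eqP; rewrite eqn_leq; apply/andP; split.
  apply: (leq_card_map (can_in_inj ofK)).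
  move=> [[a b] c]; rewrite !inE /h0_index_pred /= => /and4P[a0 c0 ac abc].
  have am := ltn_ord a; have bm := ltn_ord b; have cm := ltn_ord c.
  rewrite /positive /of_h0 /=; case: (ltnP 1 c) => c1; [case: (ltnP b.+1 m) => b1|];
    rewrite /= !ordE; lia.
apply: (leq_card_map (can_in_inj toK)).
move=> [[a b] c]; rewrite !inE /positive /= => /and4P[a0 b0 c0 abc].
have am := ltn_ord a; have bm := ltn_ord b; have cm := ltn_ord c.
rewrite /h0_index_pred /to_h0 /=; case: (ltnP c.+1 m) => c1; [|case: (ltnP 1 b) => b1];
  rewrite /= -?val_eqE /= !ordE; lia.
Qed.

Lemma coef_expX3 :
  ((\sum_(1 <= k < m) 'X^k) ^+ 3 : {poly nat})`_j = #|[pred e | positive e]|.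
Proof.
have -> : \sum_(1 <= k < m) 'X^k = \sum_(k < m | (0 < k)%N) 'X^k :> {poly nat}.
  by rewrite (@big_nat_widenl _ _ _ 1 0) // big_mkord.
rewrite !exprS expr0 mulr1 mulr_suml coef_sum.
under eq_bigr => a _ do rewrite mulr_suml mulr_sumr coef_sum.
under eq_bigr => a _ do under eq_bigr => b _ do rewrite !mulr_sumr coef_sum.
rewrite pair_big /= pair_big /= -sum1_card big_mkcond [RHS]big_mkcond.
apply: eq_bigr => -[[a b] c] _; rewrite inE /positive /= -!exprD coefXn.
by case: (0 < a)%N (0 < b)%N (0 < c)%N => [] [] [] //=; rewrite addnA eq_sym; case: eqP.
Qed.

Lemma coef_sumX : (\sum_(1 <= k < m) 'X^k : {poly nat})`_j = (0 < j < m)%N.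
Proof.
rewrite coef_sum; under eq_bigr do rewrite coefXn.
have [/andP[j0 jm]|jm] := boolP (0 < j < m)%N.
  rewrite (bigD1_seq j) ?iota_uniq ?mem_index_iota ?j0 //= eqxx big1 // => k.
  by rewrite eq_sym => /negbTE ->.
rewrite big_seq big1 // => k; rewrite mem_index_iota => km.
by case: eqP => // jk; rewrite jk km in jm.
Qed.

End TriangleCard.

(** * The cohomology of the triangle *)

Section TriangleCohomology.
Variables (m : nat) (m_gt0 : (0 < m)%N).

Definition null_additive (U V : zmodType) : {additive U -> V} := \0.

Lemma bigraded_trivial i j :
    (forall z : cochain m triangle i, differential z = 0 ->
       (forall s, homogeneous j (z s)) -> in_image z) ->
  exists f : {additive bigraded_cohomology m triangle i j -> {ffun 'I_0 -> int}},
    bijective f.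
Proof.
move=> zB; apply: (@bigraded_iso m triangle i j _ (null_additive _ _)).
  by move=> z dz zj; split=> // _; exact: zB.
move=> w; exists 0; split; first exact: raddf0.
  by move=> s a; rewrite ffunE eqxx.
by apply/ffunP => -[].
Qed.

Lemma triangle_H1_free j : (0 < j < m)%N ->
  exists f : {additive bigraded_cohomology m triangle 1 j -> {ffun 'I_1 -> int}},
    bijective f.
Proof.
move=> jm; pose phi (x : cochain m triangle 1) := [ffun _ : 'I_1 => h1_class j x].
have phiB : zmod_morphism phi.
  by move=> x y; apply/ffunP => k; rewrite !ffunE h1_classB.
pose phiM := GRing.isZmodMorphism.Build _ _ phi phiB.
pose phiA : {additive cochain m triangle 1 -> {ffun 'I_1 -> int}} :=
  HB.pack phi phiM.
have [j0 jlt] := andP jm.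
apply: (@bigraded_iso m triangle 1 j _ phiA).
  move=> z dz zj; rewrite -(h1_free m_gt0 jm dz zj); split=> [/ffunP/(_ ord0)|z0].
    by rewrite !ffunE.
  by apply/ffunP => k; rewrite !ffunE.
move=> w; exists (h1_gen m j *~ w ord0); split.
- by rewrite differentialMz h1_gen_closed // mul0rz.
- move=> s a; rewrite dprod_mulrzE ffunMzE => h.
  apply: (h1_gen_homogeneous m_gt0 (s := s) j0).
  by apply: contraNneq h => ->; rewrite mul0rz.
apply/ffunP => k; rewrite ffunE h1_classMz h1_class_gen ?mul1r ?(ord1 k) //.
  by rewrite j0 ltnW.
exact: leq_ltn_trans jlt.
Qed.

(** The type ['I_m.-1.+1] carries the group Z/m for every [m > 0], including the trivial group for
    [m = 1]. *)
Lemma inZp1_mulrz_eq0 (n : int) :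
  (inZp 1 : 'I_m.-1.+1) *~ n = 0 <-> exists k : int, n = k * m.
Proof.
have mE : m.-1.+1 = m by exact: prednK.
have um (p : nat) : (inZp 1 : 'I_m.-1.+1) *+ p = inZp p.
  by rewrite Zp_mulrn; apply: val_inj; rewrite /= modnMml mul1n.
have mu0 : (inZp 1 : 'I_m.-1.+1) *~ m = 0.
  by rewrite -pmulrn um; apply: val_inj; rewrite /= mE modnn.
split=> [n0|[k ->]]; last by rewrite mulrC mulrzA mu0 mul0rz.
exists (n %/ m)%Z; have := divz_eq n m; set r := (n %% m)%Z => nE.
have r0 : 0 <= r by apply: modz_ge0; lia.
have rm : r < m by apply: ltz_pmod; lia.
case: r r0 rm nE => // r _ rm nE; move: n0.
rewrite {1}nE mulrzDr mulrC mulrzA mu0 mul0rz add0r -pmulrn um.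
move=> /(congr1 val) /=; rewrite mE modn_small // => r0.
by move: nE; rewrite r0 addr0 [RHS]mulrC.
Qed.

Theorem triangle_H1_torsion :
  exists f : {additive bigraded_cohomology m triangle 1 m -> 'I_m.-1.+1},
    bijective f.
Proof.
pose phi (x : cochain m triangle 1) := (inZp 1 : 'I_m.-1.+1) *~ h1_class m x.
have phiB : zmod_morphism phi.
  by move=> x y; rewrite /phi h1_classB mulrzBr.
pose phiM := GRing.isZmodMorphism.Build _ _ phi phiB.
pose phiA : {additive cochain m triangle 1 -> 'I_m.-1.+1} := HB.pack phi phiM.
apply: (@bigraded_iso m triangle 1 m _ phiA).
  by move=> z dz zj; rewrite -(h1_torsion m_gt0 dz zj); exact: inZp1_mulrz_eq0.
move=> w; exists (h1_gen m m *~ (w : nat)); split.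
- by rewrite differentialMz h1_gen_closed // mul0rz.
- move=> s a; rewrite dprod_mulrzE ffunMzE => h.
  apply: (h1_gen_homogeneous m_gt0 (s := s) m_gt0).
  by apply: contraNneq h => ->; rewrite mul0rz.
(* For [m = 1] the generator is zero, but so is the target. *)
have [m1|m1] := leqP m 1.
  have w0 (x : 'I_m.-1.+1) : x = ord0.
    by apply: val_inj => /=; have := ltn_ord x; lia.
  by rewrite (w0 w) (w0 (phiA _)).
rewrite /= /phi h1_classMz h1_class_gen ?m_gt0 ?leqnn // mul1r -pmulrn Zp_mulrn.
by apply: val_inj; rewrite /= modnMml mul1n modn_small.
Qed.

Lemma triangle_iso i j : (i, j) <> (1%N, m) ->
  exists (T : finType)
    (f : {additive bigraded_cohomology m triangle i j -> {ffun T -> int}}),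
    bijective f /\
    #|T| = (((\sum_(1 <= k < m) 'X^k) ^+ 3)%:P
      + 'X * (\sum_(1 <= k < m) 'X^k)%:P : {poly {poly nat}})`_i`_j.
Proof.
move=> ij; have PE : (((\sum_(1 <= k < m) 'X^k) ^+ 3)%:P
    + 'X * (\sum_(1 <= k < m) 'X^k)%:P : {poly {poly nat}})`_i`_j =
  if i is 0 then #|h0_index m j| else if i is 1 then (0 < j < m)%N else 0%N.
  rewrite !coefD !coefC coefXM coefC card_h0_index // -coef_expX3 // -coef_sumX //.
  by case: i {ij} => [|[|i]] /=; rewrite ?coef0 ?addr0 ?add0r.
rewrite {}PE; case: i ij => [|[|[|[|i]]]] ij.
- by have [f fb] := triangle_H0 m_gt0 j; exists (h0_index m j), f.
- have [jm|jm] := boolP (0 < j < m)%N.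
    by have [f fb] := triangle_H1_free jm; exists 'I_1, f; rewrite card_ord.
  have [|f fb] := @bigraded_trivial 1 j; last by exists 'I_0, f; rewrite card_ord.
  move=> z; apply: h1_trivial => //.
  have jm' : j <> m by move=> jm'; apply: ij; rewrite jm'.
  by lia.
- have [|f fb] := @bigraded_trivial 2 j; last by exists 'I_0, f; rewrite card_ord.
  by move=> z dz _; exact: triangle_H2.
- have [|f fb] := @bigraded_trivial 3 j; last by exists 'I_0, f; rewrite card_ord.
  by move=> z dz _; exact: triangle_H3.
have [|f fb] := @bigraded_trivial i.+4 j; last by exists 'I_0, f; rewrite card_ord.
move=> z _ _; exists 0; exact: cochain_gt3.
Qed.

Lemma H1_torsionP (x : bigraded_cohomology m triangle 1 m) : x *+ m = 0.
Proof.
have [f fb] := triangle_H1_torsion; apply: (bij_inj fb).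
rewrite raddfMn raddf0 Zp_mulrn; apply: val_inj => /=.
by rewrite -[X in (_ * X)%N](prednK m_gt0) modnMl.
Qed.

Lemma ffun_int_torsion_free (T : finType) (y : {ffun T -> int}) n :
  (0 < n)%N -> y *+ n = 0 -> y = 0.
Proof.
move=> n0 /ffunP yn; apply/ffunP => t; have := yn t; rewrite ffunMnE !ffunE.
by move/eqP; rewrite mulrn_eq0 eqn0Ngt n0 => /eqP.
Qed.

Lemma dim_triangle i j : dim_tensor_rat (bigraded_cohomology m triangle i j)
  ((((\sum_(1 <= k < m) 'X^k) ^+ 3)%:P
      + 'X * (\sum_(1 <= k < m) 'X^k)%:P : {poly {poly nat}})`_i`_j)%R.
Proof.
have [[-> ->]|ij] := eqVneq (i, j) (1%N, m); last first.
  have [T [f [[g fK gK] <-]]] := triangle_iso (elimN eqP ij).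
  apply: (@dim_tensor_rat_surj _ _ f) => [y|x fx]; first by exists (g y); rewrite gK.
  by exists 1%N => //; rewrite mulr1n -[x]fK fx -(raddf0 f) fK.
(* At (1, m) the coefficient is 0, and the group is torsion, so the map to Z^0 computes its
   dimension. *)
rewrite !coefD !coefC coefXM coefC /= ?coef0 ?add0r coef_sumX ltnn andbF.
rewrite if_same -[X in dim_tensor_rat _ X]/0%N.
rewrite -[X in dim_tensor_rat _ X](card_ord 0).
apply: (@dim_tensor_rat_surj _ _ (null_additive _ _)) => [y|x _].
  by exists 0; apply/ffunP => -[].
by exists m => //; exact: H1_torsionP.
Qed.

End TriangleCohomology.

Lemma dsum_mulrnE (K : choiceType) (M : K -> zmodType) (x : dsum M) n k :
  dsum_val (x *+ n) k = dsum_val x k *+ n.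
Proof.
rewrite -dprod_mulrnE.
exact: (congr1 (fun y : dprod M => y k) (raddfMn val n x)).
Qed.

Lemma dsum_mulrn_eq0 (K : choiceType) (M : K -> zmodType) (x : dsum M) n :
  x *+ n = 0 <-> forall k, dsum_val x k *+ n = 0.
Proof.
split=> [xn k|xn]; first by rewrite -dsum_mulrnE xn.
apply: val_inj; apply: functional_extensionality_dep => k.
by rewrite -[RHS](xn k); exact: dsum_mulrnE.
Qed.

From mathcomp Require Import classical_sets.

Theorem theorem26 (m : nat) (hm : (0 < m)%N) :
  [/\ torsion (dsum (fun p : nat * nat => bigraded_cohomology m triangle p.1 p.2))
        = summand (1%N, m),
      exists f : {additive bigraded_cohomology m triangle 1 m -> 'I_m.-1.+1},
        bijective f
    & is_poincare (fun i j => bigraded_cohomology m triangle i j)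
        (((\sum_(1 <= k < m) 'X^k) ^+ 3)%:P + 'X * (\sum_(1 <= k < m) 'X^k)%:P)].
Proof.
split; [|exact: triangle_H1_torsion|by move=> i j; exact: dim_triangle].
apply/seteqP; split=> x.
  (* A torsion element has torsion components, and these vanish in the free bidegrees. *)
  move=> [n n0 xn] [i j] ij.
  have [T [f [fb _]]] := triangle_iso hm ij; apply: (bij_inj fb); rewrite raddf0.
  apply: (ffun_int_torsion_free n0).
  have xij := iffLR (dsum_mulrn_eq0 _ _) xn (i, j).
  by rewrite -raddfMn -[RHS](raddf0 f); congr (f _); exact: xij.
move=> xs; exists m => //; apply: (iffRL (dsum_mulrn_eq0 _ _)) => p.
have [->|/eqP p1m] := eqVneq p (1%N, m); first exact: H1_torsionP.
by rewrite (xs p p1m) mul0rn.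
Qed.
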